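(* Let $F$ be a field of characteristic two and let $(A,\sigma)$ be a totally decomposable central simple $F$-algebra of degree $2^n$ with orthogonal involution, and let $x\in\mathrm{Sym}(A,\sigma)^+$ with $x^2\notin F^2$. If $\mathfrak i(A,\sigma)=n-1$, then the following are equivalent: (1) there exists a $\sigma$-invariant quaternion subalgebra $Q$ of $A$ containing $x$; (2) there exists an inseparable subalgebra $S$ of $(A,\sigma)$ with $x\in S$.
   Context: Involutions are of the first kind. $(A,\sigma)$ is totally decomposable if $(A,\sigma)\simeq\bigotimes_{i=1}^n(Q_i,\sigma_i)$ with quaternion $F$-algebras with involution $(Q_i,\sigma_i)$. $\mathrm{Sym}(A,\sigma)^+=\{x\in A\mid \sigma(x)=x,\ x^2\in F\}$. A $\sigma$-invariant quaternion subalgebra is an $F$-subalgebra which is a quaternion $F$-algebra and is stable under $\sigma$. An inseparable subalgebra is a $2^n$-dimensional subalgebra $S\subseteq\mathrm{Sym}(A,\sigma)^+$ with $C_A(S)=S$, generated as an $F$-algebra by $n$ elements. Bilinear Pfister form: $\langle\!\langle\alpha_1,\dots,\alpha_n\rangle\!\rangle=\langle1,\alpha_1\rangle\otimes\cdots\otimes\langle1,\alpha_n\rangle$; $\langle\!\langle1\rangle\!\rangle^r$ denotes the $r$-fold form $\langle\!\langle1,\dots,1\rangle\!\rangle$ ($\langle\!\langle1\rangle\!\rangle^0=\langle1\rangle$). The Pfister invariant $\mathfrak{Pf}(A,\sigma)=\langle\!\langle\alpha_1,\dots,\alpha_n\rangle\!\rangle$, where $\alpha_i$ represents $\mathrm{disc}\,\sigma_i\in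 F^\times/F^{\times2}$ (independent of the decomposition up to isometry). Every bilinear Pfister form $\mathfrak b$ is isometric to $\langle\!\langle1\rangle\!\rangle^r\otimes\mathfrak b'$ with $\mathfrak b'$ an anisotropic bilinear Pfister form; this integer $r$ is denoted $\mathfrak i(\mathfrak b)$, and $\mathfrak i(A,\sigma):=\mathfrak i(\mathfrak{Pf}(A,\sigma))$. *)

(* Defs.v *)
From HB Require Import structures.
From mathcomp Require Import all_boot all_order all_algebra all_field.
Set Implicit Arguments. Unset Strict Implicit. Unset Printing Implicit Defensive.
Import GRing.Theory.
Local Open Scope ring_scope.

Section CSA.
Variables (F : fieldType) (A : falgType F).

(* unital F-subalgebra *)
Definition is_subalg (B : {vspace A}) : Prop := (1 \in B) /\ (B * B <= B)%VS.

(* B is a (unital) subalgebra which is a central simple F-algebra *)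
Definition is_csa_sub (B : {vspace A}) : Prop :=
  [/\ is_subalg B, 'Z(B)%VS = 1%VS &
      forall I : {vspace A}, (I <= B)%VS -> (B * I <= I)%VS -> (I * B <= I)%VS ->
        I = 0%VS \/ I = B].

(* quaternion F-algebra = central simple F-algebra of degree 2 *)
Definition is_quat_sub (B : {vspace A}) : Prop := is_csa_sub B /\ \dim B = 4%N.

(* involution of the first kind (F-linear since s : 'End(A)) *)
Definition is_involution (s : 'End(A)) : Prop :=
  (forall x y, s (x * y) = s y * s x) /\ (forall x, s (s x) = x).

(* in characteristic 2, a first-kind involution is symplectic iff
   1 \in Symd(A,s) = {a + s a}; orthogonal = not symplectic (KMRT 2.6) *)
Definition orthogonal_char2 (s : 'End(A)) : Prop := ~ exists a : A, a + s a = 1.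

(* Sym(A,s)^+ *)
Definition sym_plus (s : 'End(A)) (x : A) : Prop :=
  s x = x /\ exists c : F, x * x = c%:A.

Definition sigma_inv (s : 'End(A)) (B : {vspace A}) : Prop := (s @: B <= B)%VS.

(* Symd(B, s|_B) *)
Definition Symd (s : 'End(A)) (B : {vspace A}) (a : A) : Prop :=
  exists2 q, q \in B & a = q + s q.

(* al \in F^x represents disc(s|_B) for a quaternion subalgebra B
   (char 2: disc = Nrd(a) = a^2 for a nonzero a in Symd(B,s|_B)) *)
Definition disc_rep (s : 'End(A)) (B : {vspace A}) (al : F) : Prop :=
  al != 0 /\ exists a : A, [/\ Symd s B a, a != 0 & a * a = al%:A].

(* internal form of (A,s) = (Q_1,s_1) (x) ... (x) (Q_n,s_n) *)
Definition total_decomp (s : 'End(A)) (n : nat) (Q : 'I_n -> {vspace A}) : Prop :=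
  [/\ forall i, is_quat_sub (Q i) /\ sigma_inv s (Q i),
      forall i j, i != j -> forall u v, u \in Q i -> v \in Q j -> u * v = v * u &
      \big[@prodv F A/1%VS]_(i < n) Q i = fullv].

(* inseparable subalgebra of (A,s) *)
Definition is_insep_sub (s : 'End(A)) (n : nat) (S : {vspace A}) : Prop :=
  [/\ is_subalg S, \dim S = (2 ^ n)%N, (forall y, y \in S -> sym_plus s y),
      'C(S)%VS = S &
      exists g : 'I_n -> A, agenv (\sum_(i < n) <[g i]>)%VS = S].

End CSA.

Section Pfister.
Variable F : fieldType.

(* Gram matrix of the bilinear Pfister form <<s_0,...,s_{m-1}>> = (x)_i <1,s_i>,
   basis indexed by bit vectors k < 2^m *)
Definition pfister (s : seq F) : 'M[F]_(2 ^ size s) :=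
  \matrix_(k, l) (if k == l then \prod_(i < size s | odd (k %/ 2 ^ i)) s`_i else 0).

Definition bf_isometric m p (M : 'M[F]_m) (N : 'M[F]_p) : Prop :=
  m = p /\ exists P : 'M[F]_(p, m), \rank P = m /\ P *m M *m P^T = N.

Definition bf_anisotropic m (M : 'M[F]_m) : Prop :=
  forall v : 'rV[F]_m, v *m M *m v^T = 0 -> v = 0.

(* i(b) = r : b ~= <<1>>^r (x) b' with b' an anisotropic bilinear Pfister form *)
Definition pf_index (al : seq F) (r : nat) : Prop :=
  exists be : seq F, bf_anisotropic (pfister be) /\
    bf_isometric (pfister al) (pfister (nseq r 1 ++ be)).

End Pfister.

(* Main.v *)
Require Import Defs.
From HB Require Import structures.
From mathcomp Require Import all_boot all_order all_algebra all_field ring zify.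
From Stdlib Require Import Classical.
Set Implicit Arguments. Unset Strict Implicit. Unset Printing Implicit Defensive.
Import GRing.Theory.
Local Open Scope ring_scope.

(* Write sigma for the involution, K = F[x], c = x^2, and C for the centralizer
   of x. The index condition says that F^2(alpha_1, ..., alpha_n) = F^2(alpha_i)
   for some non-square alpha_i. Since a |-> sigma(a) a is additive modulo
   symmetrized elements, this makes F^2(alpha_i) the field of all f such that
   sigma(b) b = f sigma(a) a modulo symmetrized elements for some a, b with
   sigma(a) a not symmetrized; in particular it contains the square of every
   element of Sym^+, and it is F^2(c) = K^2.

   Both conditions lead to a symmetric idempotent p in C with p C p = K p such
   that the K-bilinear form (u, v) |-> sigma(u) v on C p takes diagonal values
   in K^2 p. As sigma is orthogonal this form is not alternating, so it has an
   orthonormal basis, which identifies A with the matrices over the quaternion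
   algebra p A p and sigma with a conjugate transposition. The diagonal copy of
   p A p is a sigma-invariant quaternion subalgebra containing x, and K together
   with the permutation matrices of the translations of (Z/2)^(n-1) spans an
   inseparable subalgebra containing x.

   If x lies in an inseparable subalgebra S, then p comes from the socle of the
   local algebra S, and the subspace S p of C p must be everything because the
   projection onto it commutes with S. If x lies in a sigma-invariant quaternion
   subalgebra, then up to a scalar x is symmetrized, and p is transported from
   the given decomposition, where products of square-zero elements u_j + k_j with
   k_j in F[u_i] have rank one in the centralizer of u_i. *)

(** * Cancellation in characteristic two *)

Section Char2.
Variables (F : fieldType) (A : falgType F).
Hypothesis char2 : 2%N \in [pchar F].

Lemma addvv2 (y : A) : y + y = 0.
Proof.
have h : (1 + 1 : F) = 0 by apply: addrr_pchar2.
by rewrite -[y]scale1r -scalerDl h scale0r.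
Qed.

Lemma oppv2 (y : A) : - y = y.
Proof. by apply/eqP; rewrite -subr_eq0 -opprD addvv2 oppr0. Qed.

Lemma addKK2 (y z : A) : y + (y + z) = z.
Proof. by rewrite addrA addvv2 add0r. Qed.

Lemma eq_add2 (y z : A) : y + z = 0 -> y = z.
Proof. by move/eqP; rewrite addr_eq0 oppv2 => /eqP. Qed.

End Char2.

(* Both sides are summed and equal terms are cancelled in pairs. *)
Ltac cancel_head2 h a :=
  first [ rewrite [a + (a + _)](addKK2 h)
        | rewrite [_ + (a + _)]addrCA; cancel_head2 h a ].
Ltac cancel2 h :=
  apply: (eq_add2 h);
  rewrite -[LHS]addr0 -?addrA ?add0r;
  repeat match goal with
  | |- ?a + _ = _ =>
     cancel_head2 h a
  end;
  try done.
Ltac expand2 h :=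
  rewrite ?(mulrDl, mulrDr) ?mulr1 ?mul1r ?mulrA;
  cancel2 h.

(** The scalars of a linear combination of products are absorbed into the left factors, so closure
    under sums suffices. *)
Lemma prodv_ind (F : fieldType) (A : falgType F) (U V : {vspace A}) (P : A -> Prop) :
  P 0 -> (forall a b, P a -> P b -> P (a + b)) ->
  (forall u v, u \in U -> v \in V -> P (u * v)) ->
  forall w, w \in (U * V)%VS -> P w.
Proof.
move=> P0 PD PM w; rewrite [in X in X -> _]unlock => /coord_span ->.
apply: big_ind => // i _.
set X := (X in coord X i w); case/allpairsP: (mem_tnth i X).
move=> [u v] /= [uU vV]; rewrite (tnth_nth 0) => ->.
by rewrite scalerAl; apply: PM; [apply: memvZ|]; apply: vbasis_mem.
Qed.

(** * Central simple subalgebras *)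

Section Simple.
Variables (F : fieldType) (A : falgType F) (B : {vspace A}).
Hypothesis csaB : is_csa_sub B.

Lemma csa_mem1 : 1 \in B. Proof. by case: csaB => -[]. Qed.

Lemma csa_memM a b : a \in B -> b \in B -> a * b \in B.
Proof. by case: csaB => -[_ /prodvP h] _ _; apply: h. Qed.

Lemma csa_center a : a \in B -> (forall z, z \in B -> z * a = a * z) ->
  exists k : F, a = k%:A.
Proof.
move=> aB aC; apply/vlineP; case: csaB => _ <- _.
by rewrite memv_cap aB; apply/centvP => z zB; rewrite aC.
Qed.

(** The two-sided ideal generated by [b] is nonzero, hence all of [B] by simplicity, so 1 is a sum
    of terms [c * b * d]. *)
Lemma csa_ideal1 b (P : A -> Prop) : b \in B -> b != 0 ->
  P 0 -> (forall u v, P u -> P v -> P (u + v)) ->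
  (forall c d, c \in B -> d \in B -> P (c * b * d)) -> P 1.
Proof.
move=> bB b0 P0 PD PM; have [[_ BB] _ simB] := csaB.
have [|||I0|IB] := simB (B * <[b]> * B)%VS.
- apply: (subv_trans _ BB); apply: prodvSl; apply: (subv_trans _ BB).
  by apply: prodvSr; rewrite -memvE.
- by rewrite !prodvA; apply: prodvSl; apply: prodvSl.
- by rewrite -prodvA; apply: prodvSr.
- have := memv_mul (memv_mul csa_mem1 (memv_line b)) csa_mem1.
  by rewrite mulr1 mul1r I0 memv0 (negbTE b0).
have: 1 \in (B * <[b]> * B)%VS by rewrite IB csa_mem1.
apply: prodv_ind => // u v uU vB.
move: u uU {IB}; apply: (prodv_ind (P := fun u => P (u * v))); first by rewrite mul0r.
  by move=> u u'; rewrite mulrDl; apply: PD.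
move=> c _ cB /vlineP[k ->]; rewrite -scalerAr scalerAl.
by apply: PM => //; apply: memvZ.
Qed.

(** If [b] is nonzero, then 1 is a sum of terms [c * b * d], and left multiplication by [a] kills
    each of them. *)
Lemma csa_prime a b : a \in B -> b \in B ->
  (forall z, z \in B -> a * z * b = 0) -> a = 0 \/ b = 0.
Proof.
move=> aB bB ab0; case: (eqVneq b 0) => [->|b0]; first by right.
left; rewrite -[a]mulr1; apply: (@csa_ideal1 b (fun u => a * u = 0)) => //.
- by rewrite mulr0.
- by move=> u v; rewrite mulrDr => -> ->; rewrite addr0.
by move=> c d cB dB; rewrite !mulrA ab0 ?mul0r.
Qed.

(* By induction on the length: once the first right factor is normalized to 1,
   the commutators of the other right factors with any y satisfy a shorter
   relation, so all right factors are scalars. *)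
Lemma csa_free_bimul (s : seq (A * A)) :
  all (fun u => (u.1 \in B) && (u.2 \in B)) s ->
  free [seq u.1 | u <- s] ->
  (forall z, z \in B -> \sum_(u <- s) u.1 * z * u.2 = 0) ->
  forall u, u \in s -> u.2 = 0.
Proof.
elim: {s}(size s) {-2}s (erefl (size s)) => [|m IH] [|[a b] s] //= [sz].
move=> /andP[/andP[aB bB] sB]; rewrite free_cons => /andP[aS sfree] rel.
suff b0 : b = 0.
  move=> u; rewrite inE => /orP[/eqP->//|us]; apply: (IH s) => // z zB.
  by have := rel z zB; rewrite big_cons /= b0 mulr0 add0r.
case: (eqVneq b 0) => // b0; case/negP: aS.
(* The [w] that occur as right factor of [a] in some relation form a two-sided ideal; it contains
   [b], hence 1. *)
pose P (w : A) := exists g : A -> A,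
  [/\ {in B, forall c, g c \in B}, w \in B &
   forall z, z \in B -> a * z * w + \sum_(u <- s) u.1 * z * g u.2 = 0].
have: P 1.
  apply: (@csa_ideal1 b) => //.
  - exists (fun=> 0); split=> [c _||z zB]; rewrite ?mem0v // mulr0 add0r big1 // => u _.
    by rewrite mulr0.
  - move=> w w' [g [gB wB gr]] [g' [gB' wB' gr']].
    exists (fun c => g c + g' c); split=> [c cB||z zB]; first by rewrite memvD ?gB ?gB'.
      by rewrite memvD.
    rewrite mulrDr; under eq_bigr do rewrite mulrDr.
    by rewrite big_split addrACA gr // gr' // addr0.
  move=> c d cB dB; exists (fun y => c * y * d); split=> [y yB||z zB].
  - by rewrite !csa_memM.
  - by rewrite !csa_memM.
  have := rel (z * c) (csa_memM zB cB); rewrite big_cons /= => /(congr1 ( *%R^~ d)).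
  rewrite mul0r mulrDl mulr_suml !mulrA => e; rewrite -[RHS]e; congr (_ + _).
  by apply: eq_bigr => u _; rewrite !mulrA.
case=> g [gB _ gr].
have gC u y : u \in s -> y \in B -> y * g u.2 = g u.2 * y.
  move=> us yB; apply/eqP; rewrite -subr_eq0; apply/eqP.
  have uB := allP sB _ us; move: uB => /andP[uB1 uB2].
  have := IH [seq (u.1, y * g u.2 - g u.2 * y) | u <- s].
  rewrite size_map => /(_ sz); rewrite -map_comp /=.
  move=> h; apply: (h _ sfree _ (u.1, y * g u.2 - g u.2 * y)) => {h}.
  - apply/allP => _ /mapP[v vs ->] /=; have /andP[-> vB] := allP sB _ vs.
    by rewrite rpredB // csa_memM // gB.
  - move=> z zB; rewrite big_map /=.
    have e1 := gr _ (csa_memM zB yB); have e2 := gr z zB.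
    have {e2} e2 : a * z * 1 * y + \sum_(u <- s) u.1 * z * g u.2 * y = 0.
      by rewrite -mulr_suml -mulrDl e2 mul0r.
    transitivity ((\sum_(u <- s) u.1 * (z * y) * g u.2) - \sum_(u <- s) u.1 * z * g u.2 * y).
      by rewrite -sumrB; apply: eq_bigr => v _; rewrite mulrBr !mulrA.
    apply/eqP; rewrite subr_eq0 -(inj_eq (addrI (a * z * y))).
    by move: e1 e2; rewrite !mulr1 !mulrA => -> ->.
  by apply/mapP; exists u.
have gS u : u \in s -> exists k : F, g u.2 = k%:A.
  move=> us; have /andP[uB1 uB2] := allP sB _ us.
  by apply: csa_center; [apply: gB|move=> z zB; apply: gC].
(* At [z = 1] the relation, whose right factors are now scalars, puts [a] in the span of the other
   left factors. *)
have := gr 1 csa_mem1; rewrite !mulr1 => /eqP; rewrite addr_eq0 => /eqP ->.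
rewrite rpredN big_seq; apply: rpred_sum => u us; have [k ->] := gS u us.
by rewrite mulr1 -scalerAr mulr1 memvZ // memv_span //; apply: map_f.
Qed.

End Simple.

Section SmallFree.
Variables (F : fieldType) (V : vectType F).

Lemma free2 (a b : V) :
  (forall f g : F, f *: a + g *: b = 0 -> f = 0 /\ g = 0) -> free [:: a; b].
Proof.
move=> h; suff: free [tuple a; b] by []; apply/freeP => k.
rewrite !big_ord_recl big_ord0 addr0 => /h[k0 k1] i.
by case: (unliftP ord0 i) => [j|] ->; rewrite ?ord1.
Qed.

Lemma free4 (a b c d : V) :
  (forall f g h k : F, f *: a + g *: b + (h *: c + k *: d) = 0 ->
     [/\ f = 0, g = 0, h = 0 & k = 0]) -> free [:: a; b; c; d].
Proof.
move=> h; suff: free [tuple a; b; c; d] by []; apply/freeP => k.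
rewrite !big_ord_recl big_ord0 addr0 addrA => /h[k0 k1 k2 k3] i.
case: (unliftP ord0 i) => [j|] -> //.
case: (unliftP ord0 j) => [l|] -> //.
by case: (unliftP ord0 l) => [q|] ->; rewrite ?ord1.
Qed.

End SmallFree.

(** * Extensions of F^2 generated by one element *)

Section InL.
Variable F : fieldType.
Hypothesis char2 : 2%N \in [pchar F].

(* The field F^2(c). *)
Definition inL (c f : F) := exists r t : F, f = r ^+ 2 + t ^+ 2 * c.

Lemma sqrD2 (a b : F) : (a + b) ^+ 2 = a ^+ 2 + b ^+ 2.
Proof. by rewrite sqrrD mulr2n (addrr_pchar2 char2) addr0. Qed.

Lemma inL_sq c r : inL c (r ^+ 2).
Proof. by exists r, 0; rewrite expr0n mul0r addr0. Qed.

Lemma inL0 c : inL c 0.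
Proof. by rewrite -[0](expr0n _ 2); apply: inL_sq. Qed.

Lemma inL1 c : inL c 1.
Proof. by rewrite -[1](expr1n _ 2); apply: inL_sq. Qed.

Lemma inL_gen c : inL c c.
Proof. by exists 0, 1; rewrite expr0n expr1n mul1r add0r. Qed.

Lemma inLD c f g : inL c f -> inL c g -> inL c (f + g).
Proof.
move=> [r [t ->]] [r' [t' ->]]; exists (r + r'), (t + t').
by rewrite !sqrD2 mulrDl addrACA.
Qed.

Lemma inLM c f g : inL c f -> inL c g -> inL c (f * g).
Proof.
move=> [r [t ->]] [r' [t' ->]]; exists (r * r' + t * t' * c), (r * t' + t * r').
by rewrite !sqrD2 // !exprMn; ring.
Qed.

Lemma inL_div c f g : inL c f -> inL c g -> inL c (f / g).
Proof.
move=> fL gL; case: (eqVneq g 0) => [->|g0]; first by rewrite invr0 mulr0; apply: inL0.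
have -> : f / g = f * g * (g^-1) ^+ 2 by rewrite expr2 mulrA mulfK.
by apply: inLM; [apply: inLM|apply: inL_sq].
Qed.

Lemma inL_trans a b f : inL a b -> inL b f -> inL a f.
Proof.
by move=> ab [r [t ->]]; apply: inLD; [|apply: inLM=> //]; apply: inL_sq.
Qed.

(** In b = r^2 + t^2 a the coefficient t is nonzero because b is not a square, so the equation can
    be solved for a. *)
Lemma inL_exchange a b : inL a b -> ~ (exists d, b = d ^+ 2) -> inL b a.
Proof.
move=> [r [t e]] nsq; case: (eqVneq t 0) => [t0|t0].
  by case: nsq; exists r; rewrite e t0 expr0n mul0r addr0.
have -> : a = (b + r ^+ 2) / t ^+ 2.
  rewrite e addrAC (addrr_pchar2 char2) add0r mulrAC divff ?mul1r //.
  by rewrite expf_neq0.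
by apply: inL_div; [apply: inLD; [apply: inL_gen|]|]; apply: inL_sq.
Qed.

End InL.

(** * The centralizer of a quadratic extension *)

Section QuadExt.
Variables (F : fieldType) (A : falgType F).
Hypothesis char2 : 2%N \in [pchar F].
Variables (x : A) (c : F).
Hypothesis xx : x * x = c%:A.

Definition inK (k : A) := exists f g : F, k = f%:A + g *: x.

Lemma inKc f : inK f%:A.
Proof. by exists f, 0; rewrite scale0r addr0. Qed.

Lemma inK0 : inK 0.
Proof. by rewrite -(scale0r 1); apply: inKc. Qed.

Lemma inK1 : inK 1.
Proof. by rewrite -[1]scale1r; apply: inKc. Qed.

Lemma inKx : inK x.
Proof. by exists 0, 1; rewrite scale0r scale1r add0r. Qed.

Lemma inKD k l : inK k -> inK l -> inK (k + l).
Proof.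
move=> [f [g ->]] [f' [g' ->]]; exists (f + f'), (g + g').
by rewrite !scalerDl addrACA.
Qed.

Lemma inKZ f k : inK k -> inK (f *: k).
Proof.
by move=> [g [h ->]]; exists (f * g), (f * h); rewrite scalerDr !scalerA.
Qed.

Lemma inKM k l : inK k -> inK l -> inK (k * l).
Proof.
move=> [f [g ->]] lK; rewrite mulrDl -!scalerAl mul1r.
apply: inKD; apply: inKZ => //; case: lK => [f' [g' ->]].
exists (g' * c), f'; rewrite mulrDr -!scalerAr mulr1 xx scalerA addrC //.
Qed.

Lemma inK_comm k y : inK k -> GRing.comm x y -> k * y = y * k.
Proof.
move=> [f [g ->]] xy; rewrite mulrDl mulrDr -!scalerAl -!scalerAr mul1r mulr1.
by rewrite xy.
Qed.

Lemma inK_commx k : inK k -> GRing.comm x k.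
Proof. by move=> kK; apply/esym/inK_comm. Qed.

Lemma inK_commK k l : inK k -> inK l -> k * l = l * k.
Proof. by move=> kK lK; apply: inK_comm => //; apply: inK_commx. Qed.

Lemma inK_sqr f g : (f%:A + g *: x) * (f%:A + g *: x) = (f ^+ 2 + g ^+ 2 * c)%:A.
Proof.
rewrite mulrDl !mulrDr -!scalerAl -!scalerAr !mul1r !mulr1 xx !scalerA.
rewrite scalerDl !expr2 [g * f]mulrC; cancel2 char2.
Qed.

Lemma inK_sq k : inK k -> exists2 f : F, k * k = f%:A & inL c f.
Proof.
move=> [f [g ->]]; rewrite inK_sqr; exists (f ^+ 2 + g ^+ 2 * c) => //.
by exists f, g.
Qed.

Lemma inL_sqrt f : inL c f -> exists2 k, inK k & k * k = f%:A.
Proof.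
by move=> [r [t ->]]; exists (r%:A + t *: x); [exists r, t|apply: inK_sqr].
Qed.

Hypothesis cns : ~ (exists d : F, c = d ^+ 2).

Lemma norm_neq0 f g : f ^+ 2 + g ^+ 2 * c = 0 -> f = 0 /\ g = 0.
Proof.
move=> e; case: (eqVneq g 0) => [g0|g0].
  by move: e; rewrite g0 expr0n mul0r addr0 => /eqP; rewrite expf_eq0 /= => /eqP.
case: cns; exists (f / g); rewrite expr_div_n.
have -> : f ^+ 2 = g ^+ 2 * c.
  by apply/eqP; rewrite -subr_eq0 (oppr_pchar2 char2) e.
by rewrite mulrC mulKf // expf_neq0.
Qed.

Lemma inK_inv k : inK k -> k != 0 -> exists l, [/\ inK l, k * l = 1 & l * k = 1].
Proof.
move=> kK k0; have [f [g e]] := kK.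
have n0 : f ^+ 2 + g ^+ 2 * c != 0.
  apply/eqP => /norm_neq0[f0 g0]; move: k0.
  by rewrite e f0 g0 !scale0r addr0 eqxx.
exists ((f ^+ 2 + g ^+ 2 * c)^-1 *: k); split; first exact: inKZ.
  by rewrite -scalerAr e inK_sqr scalerA mulVf // scale1r.
by rewrite -scalerAl e inK_sqr scalerA mulVf // scale1r.
Qed.

Lemma inK_cancel k y : inK k -> k * y = 0 -> k = 0 \/ y = 0.
Proof.
move=> kK ky; case: (eqVneq k 0) => [|k0]; first by left.
have [l [_ _ lk]] := inK_inv kK k0.
by right; rewrite -[y]mul1r -lk -mulrA ky mulr0.
Qed.

Lemma inK_cancelr k y : inK k -> y * k = 0 -> k = 0 \/ y = 0.
Proof.
move=> kK ky; case: (eqVneq k 0) => [|k0]; first by left.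
have [l [_ kl _]] := inK_inv kK k0.
by right; rewrite -[y]mulr1 -kl mulrA ky mul0r.
Qed.

Lemma inK_eq0 f g : f%:A + g *: x = 0 -> f = 0 /\ g = 0.
Proof.
move=> e; apply: norm_neq0; apply/eqP; move: (inK_sqr f g).
rewrite e mulr0 => /esym/eqP; rewrite scaler_eq0 oner_eq0 orbF //.
Qed.

Lemma freeK y : y != 0 -> free [:: x * y; y].
Proof.
move=> y0; apply: free2 => f g.
rewrite scalerAl -[X in _ + g *: X]mul1r [g *: (1 * y)]scalerAl -mulrDl addrC => e.
have [|/inK_eq0[]|/eqP] := inK_cancel _ e => //; last by rewrite (negbTE y0).
by exists g, f.
Qed.

Lemma freeKr y : y != 0 -> free [:: y * x; y].
Proof.
move=> y0; apply: free2 => f g.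
rewrite scalerAr -[X in _ + g *: X]mulr1 [g *: (y * 1)]scalerAr -mulrDr addrC => e.
have [|/inK_eq0[]|/eqP] := inK_cancelr _ e => //; last by rewrite (negbTE y0).
by exists g, f.
Qed.

(** Commutators with [x] centralize [x] because x^2 is a scalar. Substituting them turns an identity
    over the centralizer into one over all of [A], to which [csa_free_bimul] applies. *)
Lemma comm_ad y : GRing.comm x (x * y + y * x).
Proof.
rewrite /GRing.comm mulrDr mulrDl !mulrA xx -!mulrA xx.
by rewrite -scalerAl -scalerAr mul1r mulr1 addrC.
Qed.

Hypothesis csaA : is_csa_sub {:A}.

(** At y = x z + z x the hypothesis becomes a x z b + a z x b = 0 for all z in [A], and the left
    factors a x and a are independent. *)
Lemma centK_prime a b : GRing.comm x a -> GRing.comm x b ->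
  (forall y, GRing.comm x y -> a * y * b = 0) -> a = 0 \/ b = 0.
Proof.
move=> xa xb ab; case: (eqVneq a 0) => [|a0]; [by left|right].
have := csa_free_bimul csaA (s := [:: (a * x, b); (a, x * b)]).
rewrite /= !memvf => /(_ isT (freeKr a0)) h.
apply: (h _ (a * x, b)); last by rewrite inE eqxx.
move=> z _; rewrite !big_cons big_nil addr0 /= -(ab _ (comm_ad z)).
by expand2 char2.
Qed.

(* The extended centroid of the centralizer of x is F[x]. *)
Lemma centK_centroid e t : GRing.comm x e -> GRing.comm x t -> e != 0 ->
  (forall y, GRing.comm x y -> t * y * e = e * y * t) ->
  exists2 k, inK k & t = k * e.
Proof.
move=> xe xt e0 te; apply: NNPP => tK.
(* If t is not in K e, then t and e are independent over the field K, so these four elements are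
   independent over F. *)
have fr : free [:: t * x; t; e * x; e].
  apply: free4 => f g h k rel.
  have {rel} rel : (g%:A + f *: x) * t = (k%:A + h *: x) * e.
    apply: (eq_add2 char2); rewrite -[RHS]rel !mulrDl -!scalerAl !mul1r xt xe.
    by rewrite [g *: t + _]addrC [k *: e + _]addrC.
  have lK : inK (g%:A + f *: x) by exists g, f.
  have rK : inK (k%:A + h *: x) by exists k, h.
  case: (eqVneq (g%:A + f *: x) 0) => [l0|l0].
    have [-> ->] := inK_eq0 l0; move: rel; rewrite l0 mul0r => /esym e1.
    have [/inK_eq0[-> ->]|/eqP] // := inK_cancel rK e1.
    by rewrite (negbTE e0).
  have [l [lK' _ l1]] := inK_inv lK l0; case: tK.
  exists (l * (k%:A + h *: x)); first exact: inKM.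
  by rewrite -mulrA -rel mulrA l1 mul1r.
(* This is the hypothesis at y = x z + z x, read as a relation for all z in [A]. *)
have := csa_free_bimul csaA (s := [:: (t * x, e); (t, x * e); (e * x, t); (e, x * t)]).
rewrite /= !memvf => /(_ isT fr) h.
have : e = 0.
  apply: (h _ (t * x, e)); last by rewrite inE eqxx.
  move=> z _; rewrite !big_cons big_nil addr0 /=.
  have := te _ (comm_ad z); rewrite !mulrDr !mulrDl !mulrA => E.
  by rewrite addrA E; cancel2 char2.
by move/eqP; rewrite (negbTE e0).
Qed.

End QuadExt.

(** * Rank-one elements of the centralizer *)

Section CentK.
Variables (F : fieldType) (A : falgType F).
Hypotheses (char2 : 2%N \in [pchar F]) (csaA : is_csa_sub {:A}).
Variables (x : A) (c : F).
Hypotheses (xx : x * x = c%:A) (cns : ~ (exists d : F, c = d ^+ 2)).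

(* The centralizer of x turns out to be a matrix algebra over K = F[x]; e has
   rank at most 1 in it. *)
Definition rank_le1 (e : A) := forall y, GRing.comm x y ->
  exists2 k, inK x k & e * y * e = k * e.

Lemma centK_prime_ex a b : GRing.comm x a -> GRing.comm x b -> a != 0 -> b != 0 ->
  exists2 y, GRing.comm x y & a * y * b != 0.
Proof.
move=> xa xb a0 b0; apply: NNPP => h.
case: (centK_prime char2 xx cns csaA xa xb) => [y xy|/eqP|/eqP].
- by apply/eqP/negPn/negP => aby; case: h; exists y.
- by rewrite (negbTE a0).
- by rewrite (negbTE b0).
Qed.

(* With C the centralizer of x: an idempotent of maximal rank in the ideal
   C e C is 1. *)
Lemma rank1_ideal1 e (P : A -> Prop) : GRing.comm x e -> e != 0 -> rank_le1 e ->
  P 0 -> (forall u v, P u -> P v -> P (u + v)) ->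
  (forall b d, GRing.comm x b -> GRing.comm x d -> P (b * e * d)) -> P 1.
Proof.
move=> xe e0 re P0 PD PM.
(* Induction on the codimension of the right ideal f A, over the idempotents f of C that satisfy
   [P], starting from 0. *)
suff H m f : (\dim {:A} - \dim (limg (amull f)) < m)%N -> f * f = f -> GRing.comm x f ->
    P f -> P 1.
  by apply: (H _ 0 (ltnSn _)); rewrite ?mulr0 //; apply: commr0.
elim: m f => // m IH f; rewrite ltnS => dimf ff xf Pf.
case: (eqVneq (1 + f) 0) => [/(eq_add2 char2)->//|h0].
set h := 1 + f in h0; have xh : GRing.comm x h by apply: commrD => //; apply: commr1.
have hh : h * h = h by rewrite /h mulrDl !mulrDr !mulr1 mul1r ff; cancel2 char2.
have fh : f * h = 0 by rewrite /h mulrDr mulr1 ff addvv2.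
have hf : h * f = 0 by rewrite /h mulrDl mul1r ff addvv2.
have [b xb hbe] := centK_prime_ex xh xe h0 e0.
have xhb : GRing.comm x (h * b) by apply: commrM.
have [d xd edhbe] := centK_prime_ex xe (commrM xhb xe) e0 hbe.
have xdh : GRing.comm x (d * h) by apply: commrM.
have fB : f * (h * b) = 0 by rewrite mulrA fh mul0r.
have Df : d * h * f = 0 by rewrite -mulrA hf mulr0.
have {edhbe} : e * (d * h * (h * b)) * e != 0.
  by move: edhbe; rewrite !mulrA -(mulrA _ h h) hh.
move: (h * b) (d * h) xhb xdh fB Df => B D xB xD fB Df DB0 {b d xb xd hbe}.
have [k kK ek] := re _ (commrM xD xB).
have k0 : k != 0 by apply: contraNneq DB0 => k0; rewrite ek k0 mul0r.
have [l [lK kl lk]] := inK_inv char2 xx cns kK k0.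
have xl := inK_commx lK.
have lC y : GRing.comm x y -> y * l = l * y by move=> xy; rewrite (inK_comm lK).
(* Since e D B e = k e, this is an idempotent. It lies in C e C and is orthogonal to f, so f + g is
   an idempotent with a larger image. *)
pose g := l * (B * e * D).
have gBe : g * (B * e) = B * e.
  have -> : g * (B * e) = l * B * (e * (D * B) * e) by rewrite /g !mulrA.
  by rewrite ek !mulrA -(mulrA l) -(inK_comm kK xB) mulrA lk mul1r.
have gg : g * g = g.
  by rewrite {2}/g mulrA lC; [rewrite -mulrA [g * _]mulrA gBe|do ?apply: commrM].
have fg : f * g = 0 by rewrite /g mulrA lC // -mulrA !mulrA -(mulrA l) fB mulr0 !mul0r.
have gf : g * f = 0 by rewrite /g -!mulrA Df !mulr0.
have g0 : g != 0.
  apply: contraNneq DB0 => g0.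
  by rewrite mulrA -(mulrA _ B) -(mulrA e D) -gBe g0 mul0r !mulr0.
have dlt : (\dim (limg (amull f)) < \dim (limg (amull (f + g)%R)))%N.
  rewrite ltnNge; apply/negP => le.
  have sub : (limg (amull f) <= limg (amull (f + g)%R))%VS.
    apply/subvP => _ /memv_imgP[y _ ->]; rewrite lfunE /=.
    have -> : f * y = amull (f + g) (f * y).
      by rewrite lfunE /= mulrDl !mulrA ff gf mul0r addr0.
    by rewrite memv_img // memvf.
  have /eqP E : limg (amull f) == limg (amull (f + g)) by rewrite eqEdim sub le.
  have : g \in limg (amull f).
    have -> : g = amull (f + g) g by rewrite lfunE /= mulrDl fg gg add0r.
    by rewrite E memv_img // memvf.
  case/memv_imgP=> y _; rewrite lfunE /= => gy; move: g0.
  by rewrite -fg gy mulrA ff eqxx.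
apply: (IH (f + g)).
- apply: leq_trans dimf; apply: ltn_sub2l => //.
  by apply: leq_trans dlt (dimvS (subvf _)).
- by rewrite mulrDl !mulrDr ff gg fg gf addr0 add0r.
- by apply: commrD => //; rewrite /g; do ?apply: commrM.
by apply: PD => //; rewrite /g !mulrA; apply: PM => //; exact: commrM.
Qed.

End CentK.

(** * Involutions in characteristic two *)

Section Involution.
Variables (F : fieldType) (A : falgType F) (s : 'End(A)).
Hypotheses (char2 : 2%N \in [pchar F]) (invs : is_involution s) (orth : orthogonal_char2 s).

Lemma invM u v : s (u * v) = s v * s u. Proof. by case: invs. Qed.
Lemma invK u : s (s u) = u. Proof. by case: invs. Qed.

Lemma inv1 : s 1 = 1.
Proof. by rewrite -[LHS]mulr1 -[X in _ * X](invK 1) -invM mulr1 invK. Qed.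

Lemma inv_comm u v : s u = u -> GRing.comm u v -> GRing.comm u (s v).
Proof. by move=> su uv; rewrite /GRing.comm -{1}su -invM -uv invM su. Qed.

Definition symd (y : A) := exists q, y = q + s q.

Lemma symd0 : symd 0.
Proof. by exists 0; rewrite linear0 addr0. Qed.

Lemma symdD y z : symd y -> symd z -> symd (y + z).
Proof. by move=> [q ->] [q' ->]; exists (q + q'); rewrite linearD addrACA. Qed.

Lemma symdZ f y : symd y -> symd (f *: y).
Proof. by move=> [q ->]; exists (f *: q); rewrite linearZ scalerDr. Qed.

Lemma symd_sym y : symd y -> s y = y.
Proof. by move=> [q ->]; rewrite linearD /= invK addrC. Qed.

Lemma symd_conj a y : symd y -> symd (a * y * s a).
Proof.
by move=> [q ->]; exists (a * q * s a); rewrite !invM invK mulrDr mulrDl !mulrA.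
Qed.

Lemma symd_scal f : symd f%:A -> f = 0.
Proof.
move=> fs; case: (eqVneq f 0) => // f0; case: orth.
have [q e] := symdZ f^-1 fs; exists q.
by rewrite -e scalerA mulVf // scale1r.
Qed.

Lemma symd_norm_add u v : symd (u * s u) -> symd (v * s v) -> symd ((u + v) * s (u + v)).
Proof.
move=> us vs; have -> : (u + v) * s (u + v) = (u * s u + v * s v) + (u * s v + s (u * s v)).
  by rewrite linearD invM invK; expand2 char2.
by apply: symdD; [apply: symdD|exists (u * s v)].
Qed.

Section Rank1.
Hypothesis csaA : is_csa_sub {:A}.
Variables (x : A) (c : F).
Hypotheses (xx : x * x = c%:A) (cns : ~ (exists d : F, c = d ^+ 2)) (sx : s x = x).

Lemma inK_sym k : inK x k -> s k = k.
Proof. by move=> [f [g ->]]; rewrite linearD !linearZ /= inv1 sx. Qed.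

(** The u with [u * s u] symmetrized are closed under addition. If they contained all [b * e * d],
    they would contain 1, which is not symmetrized as sigma is orthogonal. *)
Lemma rank1_not_symd e : GRing.comm x e -> e != 0 -> rank_le1 x e ->
  (forall b d, GRing.comm x b -> GRing.comm x d -> symd (b * e * d * s (b * e * d))) ->
  False.
Proof.
move=> xe e0 re H.
have := rank1_ideal1 char2 csaA xx cns xe e0 re (P := fun u => symd (u * s u)).
rewrite mul0r inv1 mulr1 => /(_ symd0 symd_norm_add H) [q e1].
by case: orth; exists q.
Qed.

(** If [e * s b * b * e] always vanished, so would [u * s u] for every [u = b * e * d], against
    [rank1_not_symd]. *)
Lemma rank1_anisotropic e : GRing.comm x e -> s e = e -> e != 0 -> rank_le1 x e ->
  exists2 b, GRing.comm x b & e * s b * b * e != 0.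
Proof.
move=> xe se e0 re; apply: NNPP => H; apply: (rank1_not_symd xe e0 re) => b d xb xd.
suff E : e * s (s d) * s d * e = 0.
  have -> : b * e * d * s (b * e * d) = b * (e * s (s d) * s d * e) * s b.
    by rewrite invK !invM se !mulrA.
  by rewrite E mulr0 mul0r; apply: symd0.
by apply/eqP/negPn/negP => nz; case: H; exists (s d) => //; apply: inv_comm.
Qed.

(** Otherwise all of K p is symmetrized, in particular [p * d * s d * p]; conjugating this by b
    gives [u * s u] for [u = b * p * d]. *)
Lemma rank1_sym_not_symd p : GRing.comm x p -> s p = p -> p != 0 -> rank_le1 x p ->
  symd p -> symd (x * p) -> False.
Proof.
move=> xp sp p0 rp ps xps; apply: (rank1_not_symd xp p0 rp) => b d xb xd.
have [|k [f [g ->]] E] := rp (d * s d).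
  by apply: commrM => //; apply: inv_comm.
have -> : b * p * d * s (b * p * d) = b * (p * (d * s d) * p) * s b.
  by rewrite !invM sp !mulrA.
rewrite E; apply: symd_conj; rewrite mulrDl -!scalerAl mul1r.
by apply: symdD; apply: symdZ.
Qed.

(** The element q = b e sigma(b) satisfies q^2 = k0 q, and k0 is invertible in K and commutes with
    q. So q / k0 is idempotent, and it inherits rank one from e. *)
Lemma rank1_idempotent e b k0 : GRing.comm x e -> s e = e -> e != 0 -> rank_le1 x e ->
  GRing.comm x b -> inK x k0 -> k0 != 0 -> e * s b * b * e = k0 * e ->
  exists l, [/\ inK x l, l * k0 = 1 & let p := l * (b * e * s b) in
    [/\ p * p = p, GRing.comm x p, s p = p, p != 0 & rank_le1 x p]].
Proof.
move=> xe se e0 re xb kK k00 ek.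
have [l [lK kl lk]] := inK_inv char2 xx cns kK k00.
exists l; split=> //= {kl}; set q := b * e * s b.
have xsb : GRing.comm x (s b) by apply: inv_comm.
have xq : GRing.comm x q by rewrite /q; do ?apply: commrM.
have ql : q * l = l * q by rewrite (inK_comm lK xq).
have qq : q * q = k0 * q.
  have -> : q * q = b * (e * s b * b * e) * s b by rewrite /q !mulrA.
  by rewrite ek mulrA -(inK_comm kK xb) /q !mulrA.
have q0 : q != 0.
  apply: contraNneq e0 => q0; have : (e * s b * b * e) * (s b * b * e) = 0.
    have -> : (e * s b * b * e) * (s b * b * e) = e * s b * q * (b * e) by rewrite /q !mulrA.
    by rewrite q0 mulr0 mul0r.
  rewrite ek -mulrA [e * _]mulrA [e * _]mulrA ek mulrA => E.
  have [kk0|->] := inK_cancel char2 xx cns (inKM xx kK kK) E => //.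
  by move: k00; case: (inK_cancel char2 xx cns kK kk0) => ->; rewrite eqxx.
have sq : s q = q by rewrite /q !invM invK se mulrA.
have rq y : GRing.comm x y -> exists2 k, inK x k & q * y * q = k * q.
  move=> xy; have [|k kK' E] := re (s b * y * b); first by do ?apply: commrM.
  exists k => //; have -> : q * y * q = b * (e * (s b * y * b) * e) * s b by rewrite /q !mulrA.
  by rewrite E (mulrA b) -(inK_comm kK' xb) /q !mulrA.
clearbody q; split.
- by rewrite mulrA -(mulrA l) ql !mulrA -(mulrA _ q) qq !mulrA -(mulrA l) lk mulr1.
- by apply: commrM => //; apply: inK_commx.
- by rewrite invM (inK_sym lK) sq ql.
- apply: contraNneq q0 => e1; have [l0|->] := inK_cancel char2 xx cns lK e1 => //.
  by move/eqP: lk; rewrite l0 mul0r eq_sym oner_eq0.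
move=> y xy; have [k kK' E] := rq _ xy; exists (k * l); first exact: (inKM xx kK' lK).
have -> : l * q * y * (l * q) = l * l * (q * y * q).
  by rewrite !mulrA -(mulrA l q y) -(mulrA l _ l) -(inK_comm lK (commrM xq xy)) !mulrA.
by rewrite E !mulrA -(mulrA l l k) !(inK_commK lK kK') !mulrA (inK_commK lK kK').
Qed.

End Rank1.
End Involution.

Lemma dimv_le1_line (F : fieldType) (V : vectType F) (U : {vspace V}) :
  (\dim U <= 1)%N -> exists2 t, t \in U & U = <[t]>%VS.
Proof.
move=> dU; exists (vpick U); first exact: memv_pick.
apply/esym/eqP; rewrite eqEdim -memvE memv_pick dim_vline.
by case: (eqVneq (vpick U) 0) => // /eqP; rewrite vpick0 => /eqP ->; rewrite dimv0.
Qed.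

(** * Quaternion subalgebras *)

Section Quaternion.
Variables (F : fieldType) (A : falgType F).
Hypothesis char2 : 2%N \in [pchar F].

Section Structure.
Variable B : {vspace A}.
Hypothesis quatB : is_quat_sub B.
Variables (u : A) (al : F).
Hypotheses (uB : u \in B) (uu : u * u = al%:A).
Hypothesis uF : ~ (exists f : F, u = f%:A).

Let csaB : is_csa_sub B. Proof. by case: quatB. Qed.
Let B1 : 1 \in B. Proof. exact: csa_mem1. Qed.
Let BM a b : a \in B -> b \in B -> a * b \in B. Proof. exact: csa_memM. Qed.
(** The inner derivation of [u]. Its square is zero since u^2 is a scalar; on [B] its image and
    kernel both turn out to have dimension 2. *)
Let delta := (amull u + amulr u)%R : 'End(A).

Let deltaE y : delta y = u * y + y * u.
Proof. by rewrite add_lfunE !lfunE. Qed.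

Let delta_comm y : delta y = 0 -> GRing.comm u y.
Proof. by rewrite deltaE => /(eq_add2 char2). Qed.

Let delta2 y : u * delta y = delta y * u.
Proof. by rewrite deltaE; apply: comm_ad uu _. Qed.

Let deltaB y : y \in B -> delta y \in B.
Proof. by move=> yB; rewrite deltaE memvD ?BM. Qed.

Let dim1u : \dim <<[:: 1; u]>> = 2.
Proof.
apply/eqP; suff: free [:: 1; u] by [].
apply: free2 => f g; case: (eqVneq g 0) => [->|g0].
  by rewrite scale0r addr0 => /eqP; rewrite scaler_eq0 oner_eq0 orbF => /eqP.
move=> /(eq_add2 char2) e; case: uF; exists (g^-1 * f).
by rewrite -scalerA e scalerA mulVf // scale1r.
Qed.

Let sub1u : (<<[:: 1%R; u]>> <= B :&: lker delta)%VS.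
Proof.
apply/span_subvP => y; rewrite !inE memv_cap memv_ker => /orP[] /eqP ->.
  by rewrite B1 deltaE mulr1 mul1r (addvv2 char2) /=.
by rewrite uB deltaE (addvv2 char2) /=.
Qed.

Let im_ker : (delta @: B <= B :&: lker delta)%VS.
Proof.
apply/subvP => _ /memv_imgP[y yB ->]; rewrite memv_cap deltaB //= memv_ker.
by rewrite [delta (delta y)]deltaE delta2 (addvv2 char2).
Qed.

(** If the image were zero, u would be central. If it were F t with t nonzero, then u t = lam t, and
    ep = u + lam would satisfy ep z ep = 0 for all z in [B]; primeness would make u a scalar. *)
Let im_gt1 : (1 < \dim (delta @: B))%N.
Proof.
rewrite ltnNge; apply/negP => /dimv_le1_line[t /memv_imgP[z0 z0B tE] imE].
have im z : z \in B -> exists f, delta z = f *: t.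
  by move=> zB; apply/vlineP; rewrite -imE memv_img.
case: (eqVneq t 0) => [t0|t0].
  have [z zB|f] := csa_center csaB uB; last by move=> e; apply: uF; exists f.
  apply/esym/delta_comm; have [f ->] := im z zB; by rewrite t0 scaler0.
have [lam] := im _ (BM uB z0B).
have -> : delta (u * z0) = u * delta z0 by rewrite !deltaE mulrDr !mulrA.
rewrite -tE => ut; case: uF; exists lam; apply: (eq_add2 char2).
set ep := u + lam%:A.
have ept : ep * t = 0 by rewrite /ep mulrDl ut -scalerAl mul1r (addvv2 char2).
have epep : ep * ep = (al + lam ^+ 2)%:A.
  rewrite /ep mulrDl !mulrDr -!scalerAl -!scalerAr !mul1r mulr1 uu !scalerA scalerDl expr2.
  by cancel2 char2.
have ep2 : ep * ep = 0.
  move: (mulr0 ep); rewrite -{1}ept mulrA epep -scalerAl mul1r => /eqP.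
  by rewrite scaler_eq0 (negbTE t0) orbF => /eqP ->; rewrite scale0r.
have epB : ep \in B by rewrite memvD // memvZ.
suff: ep = 0 \/ ep = 0 by case.
apply: (csa_prime csaB) => // z zB; have [f fE] := im z zB.
have : ep * (ep * z + z * ep) = 0.
  have -> : ep * z + z * ep = delta z.
    rewrite deltaE /ep !mulrDl !mulrDr -scalerAl -scalerAr mul1r mulr1; cancel2 char2.
  by rewrite fE -scalerAr ept scaler0.
by rewrite mulrDr !mulrA ep2 mul0r add0r.
Qed.

Let dims : \dim (B :&: lker delta) = 2 /\ \dim (delta @: B) = 2.
Proof.
have := limg_ker_dim delta B; have := dimvS sub1u; have := dimvS im_ker.
have := im_gt1; rewrite dim1u; case: quatB => _ ->.
move: (\dim _) (\dim _) => [|[|[|p]]] [|[|[|q]]] //=; lia.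
Qed.

Lemma quat_cent y : y \in B -> GRing.comm u y -> inK u y.
Proof.
move=> yB uy; have : y \in (B :&: lker delta)%VS.
  by rewrite memv_cap yB memv_ker deltaE uy (addvv2 char2) /=.
have [d _] := dims.
have /eqP <- : <<[:: 1%R; u]>>%VS == (B :&: lker delta)%VS.
  by rewrite eqEdim sub1u dim1u d.
rewrite span_cons span_seq1 => /memv_addP[_ /vlineP[f ->] [_ /vlineP[g ->] ->]].
by exists f, g.
Qed.

(** Image and kernel of [delta] on [B] coincide by dimension, and u lies in the kernel. *)
Lemma quat_ad : exists2 w, w \in B & u * w + w * u = u.
Proof.
have [d d'] := dims.
have : u \in (delta @: B)%VS.
  have /eqP -> : (delta @: B)%VS == (B :&: lker delta)%VS by rewrite eqEdim im_ker d d'.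
  by rewrite memv_cap uB memv_ker deltaE (addvv2 char2) /=.
by case/memv_imgP => w wB e; exists w => //; rewrite -deltaE.
Qed.

(** The coefficient l is chosen with l u = delta(y). Since delta(l w) = l u, the element y + l w
    centralizes u and lies in F[u]. *)
Lemma quat_span w y : al != 0 -> w \in B -> u * w + w * u = u -> y \in B ->
  exists k l, [/\ inK u k, inK u l & y = k + l * w].
Proof.
move=> al0 wB uw yB.
have [a [b e]] := quat_cent (deltaB yB) (delta2 y).
pose l := b%:A + (al^-1 * a) *: u.
have lK : inK u l by exists b, (al^-1 * a).
exists (y + l * w), l; split=> //; last by rewrite -addrA (addvv2 char2) addr0.
apply: quat_cent; first by rewrite memvD // BM // /l memvD ?memvZ.
apply: delta_comm; rewrite linearD /= e [delta (l * w)]deltaE mulrA.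
rewrite -(inK_comm lK) // -!mulrA -mulrDr uw /l mulrDl -!scalerAl mul1r uu scalerA.
rewrite mulrAC mulVf // mul1r; by cancel2 char2.
Qed.

End Structure.

Section Criterion.
Variables (x W k1 : A) (c : F).
Hypotheses (xx : x * x = c%:A) (c0 : c != 0).
Hypotheses (xW : x * W + W * x = x) (WW : W * W = W + k1) (k1K : inK x k1).

Definition quat_gen := <<[:: 1; x; W; x * W]%R>>%VS.

Lemma quat_genP y : y \in quat_gen <-> exists k l, [/\ inK x k, inK x l & y = k + l * W].
Proof.
rewrite /quat_gen !span_cons span_nil addv0; split.
  case/memv_addP => _ /vlineP[f ->] [_ /memv_addP[_ /vlineP[g ->] [z H ->]] ->].
  case/memv_addP: H => _ /vlineP[h ->] [_ /vlineP[k ->] ->].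
  exists (f%:A + g *: x), (h%:A + k *: x); split; [by exists f, g|by exists h, k|].
  by rewrite mulrDl -!scalerAl mul1r -addrA.
move=> [_ [_ [[f [g ->]] [h [k ->]] ->]]].
rewrite mulrDl -!scalerAl mul1r -addrA.
by do ![apply: memv_add]; apply: memvZ; apply: memv_line.
Qed.

Let Wx : W * x = x * W + x.
Proof. by apply: (eq_add2 char2); rewrite -[X in _ + (_ + X)]xW; cancel2 char2. Qed.

Let x0 : x != 0.
Proof.
apply: contraNneq c0 => x0; move/eqP: xx; rewrite x0 mul0r eq_sym.
by rewrite scaler_eq0 oner_eq0 orbF.
Qed.

Let Wk k : inK x k -> exists2 l, inK x l & W * k = k * W + l.
Proof.
move=> [f [g ->]]; exists (g *: x); first by apply: inKZ; apply: inKx.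
rewrite mulrDl mulrDr -!scalerAl -!scalerAr mul1r mulr1 Wx scalerDr addrA //.
Qed.

Let xr y : y * x = 0 -> y = 0.
Proof.
move=> yx; have : y * x * x = 0 by rewrite yx mul0r.
rewrite -mulrA xx -scalerAr mulr1 => /eqP.
by rewrite scaler_eq0 (negbTE c0) => /eqP.
Qed.

Let genM y z : y \in quat_gen -> z \in quat_gen -> y * z \in quat_gen.
Proof.
have KM k z' : inK x k -> z' \in quat_gen -> k * z' \in quat_gen.
  move=> kK /quat_genP[m [l [mK lK ->]]]; apply/quat_genP.
  by exists (k * m), (k * l); split; rewrite ?mulrDr ?mulrA //; apply: inKM xx _ _ _ _.
have WM z' : z' \in quat_gen -> W * z' \in quat_gen.
  move=> /quat_genP[m [l [mK lK ->]]].
  have [m' mK' em] := Wk mK; have [l' lK' el] := Wk lK.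
  apply/quat_genP; exists (m' + l * k1), (m + l + l').
  split; [|by do ![apply: inKD]|].
    by apply: inKD => //; apply: inKM xx _ _ _ _.
  by rewrite mulrDr mulrA em el !mulrDl -(mulrA l W W) WW mulrDr; cancel2 char2.
move=> /quat_genP[k [l [kK lK ->]]] zQ.
by rewrite mulrDl memvD // -?mulrA; apply: KM => //; apply: WM.
Qed.

Let Kgen k : inK x k -> k \in quat_gen.
Proof.
move=> kK; apply/quat_genP; exists k, 0; split=> //; first exact: inK0.
by rewrite mul0r addr0.
Qed.

Let Wgen : W \in quat_gen.
Proof.
apply/quat_genP; exists 0, 1; split; [exact: inK0|exact: inK1|].
by rewrite mul1r add0r.
Qed.

Let ad_x k l : inK x k -> inK x l -> x * (k + l * W) + (k + l * W) * x = l * x.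
Proof.
move=> kK lK; rewrite mulrDl mulrDr -(inK_commx kK) !mulrA -(inK_commx lK).
by rewrite -!mulrA Wx mulrDr (mulrA l x) -(inK_commx lK) !mulrA; cancel2 char2.
Qed.

Let ad_W f g : W * (f%:A + g *: x) + (f%:A + g *: x) * W = g *: x.
Proof.
rewrite mulrDl mulrDr -!scalerAl -!scalerAr mul1r mulr1 Wx scalerDr.
by cancel2 char2.
Qed.

(** Commutation with x sends k + l W to l x, and commutation with W sends f + g x to g x. These two
    maps yield the independence of the spanning elements, the center and the simplicity. *)
Lemma quat_gen_quat : is_quat_sub quat_gen.
Proof.
have one : 1 \in quat_gen by apply: Kgen; apply: inK1.
have xgen : x \in quat_gen by apply: Kgen; apply: inKx.
have K0 f g : f%:A + g *: x = 0 -> f = 0 /\ g = 0.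
  move=> e; have := ad_W f g; rewrite e mulr0 mul0r addr0 => /esym/eqP.
  rewrite scaler_eq0 (negbTE x0) orbF => /eqP g0; move/eqP: e.
  by rewrite g0 scale0r addr0 scaler_eq0 oner_eq0 orbF => /eqP.
split; last first.
  apply/eqP; suff: free [:: 1; x; W; x * W] by [].
  apply: free4 => f g h k; rewrite scalerAl -{1}[W]mul1r scalerAl -mulrDl => e.
  have kK : inK x (f%:A + g *: x) by exists f, g.
  have lK : inK x (h%:A + k *: x) by exists h, k.
  have := ad_x kK lK; rewrite e mulr0 mul0r addr0 => /esym/xr l0.
  have [h0 k0] := K0 _ _ l0; move: e; rewrite l0 mul0r addr0 => /K0[-> ->].
  by rewrite h0 k0.
split.
- by split=> //; apply/prodvP => y z; apply: genM.
- apply/eqP; rewrite eqEsubv; apply/andP; split; last first.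
    apply/subvP => _ /vlineP[f ->]; rewrite memv_cap; apply/andP; split.
      by rewrite memvZ.
    by apply/centvP => y _; rewrite -scalerAl -scalerAr mul1r mulr1.
  apply/subvP => y; rewrite memv_cap => /andP[/quat_genP[k [l [kK lK ->]]] /centvP yC].
  have := ad_x kK lK; rewrite yC // (addvv2 char2) => /esym/xr l0.
  move: yC; rewrite l0 mul0r addr0 => yC; case: kK yC => f [g ->] yC.
  have := ad_W f g; rewrite yC // (addvv2 char2) => /esym/eqP.
  rewrite scaler_eq0 (negbTE x0) orbF => /eqP ->.
  by rewrite scale0r addr0 memvZ // memv_line.
move=> I IQ /prodvP QI /prodvP IQ'; case: (eqVneq I 0%VS) => [|I0]; [by left|right].
apply/eqP; rewrite eqEsubv IQ; apply/subvP => y yQ; rewrite -[y]mulr1; apply: (QI) => //.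
have unitI f : f != 0 -> f%:A \in I -> 1 \in I.
  by move=> f0 fI; rewrite -[1]scale1r -(mulVf f0) -scalerA memvZ.
have xI : x \in I -> 1 \in I.
  by move=> xI; apply: (unitI c) => //; rewrite -xx; apply: (QI).
(* A nonzero f + g x in I is a nonzero scalar if g = 0; otherwise its commutator with W is a nonzero
   multiple of x. *)
have KI k : inK x k -> k \in I -> k != 0 -> 1 \in I.
  move=> [f [g ->]] kI k0; have := ad_W f g; case: (eqVneq g 0) => [g0|g0] e.
    apply: (unitI f); last by move: kI; rewrite g0 scale0r addr0.
    by apply: contraNneq k0 => ->; rewrite g0 !scale0r addr0.
  apply: (xI); rewrite -[x]scale1r -(mulVf g0) -scalerA memvZ // -e.
  by apply: memvD; [apply: (QI)|apply: (IQ')].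
have := memv_pick I; have : vpick I != 0 by rewrite vpick0.
move: (vpick I) => {yQ}{}y y0 yI; have /quat_genP[k [l [kK lK yE]]] := subvP IQ _ yI.
case: (eqVneq l 0) => [l0|l0].
  by move: yI y0; rewrite yE l0 mul0r addr0; apply: KI.
apply: (KI (l * x)); first by apply: inKM xx _ _ _ _ => //; apply: inKx.
  by rewrite -(ad_x kK lK) -yE; apply: memvD; [apply: (QI)|apply: (IQ')].
by apply: contraNneq l0 => /xr ->.
Qed.

End Criterion.
End Quaternion.

(** * Orthonormal bases over F[x] *)

Section Orthonormal.
Variables (F : fieldType) (A : falgType F) (s : 'End(A)).
Hypotheses (char2 : 2%N \in [pchar F]) (invs : is_involution s).
Variables (x : A) (c : F).
Hypotheses (xx : x * x = c%:A) (cns : ~ (exists d : F, c = d ^+ 2)) (sx : s x = x).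
Variable p : A.
Hypotheses (sp : s p = p) (p0 : p != 0) (rp : rank_le1 x p).

(* The vectors are elements v = v * p of A, with the form (u, v) |-> s u * v. *)
Fixpoint orthofam (vs : seq A) : Prop :=
  if vs is v :: vs' then
    [/\ s v * v = p, forall u, u \in vs' -> s v * u = 0 & orthofam vs']
  else True.

(** For an orthonormal family, left multiplication by this element is the orthogonal projection of C
    p onto the K-span of the family. *)
Definition famproj (vs : seq A) : A := \sum_(v <- vs) v * s v.

Lemma proj_sym vs : s (famproj vs) = famproj vs.
Proof.
rewrite /famproj linear_sum /=; apply: eq_bigr => v _.
by rewrite (invM invs) (invK invs).
Qed.

Lemma orthonormal_free vs : orthofam vs -> free vs.
Proof.
elim: vs => [|v vs IH] /=; first by rewrite nil_free.
case=> vv vu /IH fr; rewrite free_cons fr andbT; apply/negP => /(@coord_span _ _ _ (in_tuple vs)) e.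
move: p0; rewrite -vv {2}e mulr_sumr big1 ?eqxx // => i _.
by rewrite -scalerAr vu ?scaler0 // mem_nth.
Qed.

Lemma proj_orthonormal vs v : orthofam vs -> v \in vs -> v * p = v -> famproj vs * v = v.
Proof.
rewrite /famproj; elim: vs => // w vs IH /= [ww wu ovs]; rewrite inE big_cons mulrDl.
case/orP => [/eqP ->|vvs] vp.
  rewrite -mulrA ww vp mulr_suml big_seq big1 ?addr0 // => u uvs.
  have -> : u * s u * w = u * s (s w * u) by rewrite (invM invs) (invK invs) mulrA.
  by rewrite wu // linear0 mulr0.
by rewrite IH // -mulrA wu // mulr0 add0r.
Qed.

Section Basis.
(** A K-subspace of C p containing p, on which the form is nondegenerate with diagonal values in K^2
    p. It will be S p for an inseparable subalgebra S in one implication, and C p in the other. *)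
Variable U : A -> Prop.
Hypothesis UC : forall y, U y -> GRing.comm x y /\ y * p = y.
Hypothesis UD : forall y z, U y -> U z -> U (y + z).
Hypothesis UK : forall k y, inK x k -> U y -> U (k * y).
Hypothesis Up : U p.
Hypothesis Und : forall y, U y -> y != 0 -> exists2 z, U z & s y * z = p.
Hypothesis UL : forall y, U y -> exists2 k, inK x k & s y * y = k * k * p.

Let form u v : U u -> U v -> exists2 k, inK x k & s u * v = k * p.
Proof.
move=> /UC[xu up] /UC[xv vp]; have [|k kK e] := rp (y := s u * v).
  by apply: commrM => //; apply: inv_comm.
by exists k => //; rewrite -e -{1}up -{1}vp (invM invs) sp !mulrA.
Qed.

Let U0 : U 0.
Proof. by rewrite -(mul0r p); apply: UK => //; apply: inK0. Qed.

Let proj_in vs y : (forall v, v \in vs -> U v) -> U y -> U (famproj vs * y).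
Proof.
move=> vU yU; rewrite /famproj mulr_suml big_seq; apply: big_ind => // v vvs.
have [k kK e] := form (vU _ vvs) yU.
have [xv vp] := UC (vU _ vvs).
by rewrite -mulrA e mulrA -(inK_comm kK xv) -mulrA vp; apply: UK => //; apply: vU.
Qed.

Let sform0 u v : s u * v = 0 -> s v * u = 0.
Proof. by move=> e; rewrite -[u](invK invs) -(invM invs) e linear0. Qed.

Let ortho_proj vs y : orthofam vs -> (forall v, v \in vs -> U v) ->
  forall v, v \in vs -> s v * (y + famproj vs * y) = 0.
Proof.
move=> ovs vU v vvs; have [_ vp] := UC (vU _ vvs).
have e := proj_orthonormal ovs vvs vp.
rewrite mulrDr mulrA -[s v * famproj vs](invK invs) (invM invs) (invK invs) proj_sym e.
by rewrite (addvv2 char2).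
Qed.

(* An anisotropic vector orthogonal to the family extends it after scaling. If
   the orthogonal complement is alternating, choose y, z in it with form 1 and
   replace a member v of the family by v + y, v + z, v + y + z. *)
Lemma orthonormal_basis : exists vs,
  [/\ orthofam vs, forall v, v \in vs -> U v & forall y, U y -> famproj vs * y = y].
Proof.
have pp : p * p = p by have [] := UC Up.
(* An orthonormal family is free, so its length is at most dim A. The start is the nonempty family
   of p alone, because the alternating case needs a member to replace. *)
suff H m vs : orthofam vs -> (forall v, v \in vs -> U v) -> vs != [::] ->
    (\dim {:A} < size vs + m)%N -> exists vs,
    [/\ orthofam vs, forall v, v \in vs -> U v & forall y, U y -> famproj vs * y = y].
  apply: (H (\dim {:A}) [:: p]) => //=.
  - by split=> //; rewrite sp.
  by move=> v; rewrite inE => /eqP ->.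
elim: m vs => [|m IH] vs ovs vU vs0 szvs.
  have /eqP dvs := orthonormal_free ovs.
  by move: szvs; rewrite addn0 ltnNge -dvs dimvS // subvf.
case: (classic (forall y, U y -> famproj vs * y = y)) => [h|]; first by exists vs.
move=> /not_all_ex_not[y0 /(imply_to_and (U y0))[y0U y0n]].
pose y := y0 + famproj vs * y0.
have yU : U y by apply: UD => //; apply: proj_in.
have yn0 : y != 0 by apply/eqP => /(eq_add2 char2) /esym.
have yo v : v \in vs -> s v * y = 0 by apply: ortho_proj.
case: (classic (exists y', [/\ U y', forall v, v \in vs -> s v * y' = 0 & s y' * y' <> 0])).
  move=> [{y0 y0U y0n yU yn0 yo}y [yU yo yy]]; have [k kK ek] := UL yU.
  have k0 : k != 0 by apply/eqP => k0; apply: yy; rewrite ek k0 !mul0r.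
  have [l [lK kl lk]] := inK_inv char2 xx cns kK k0.
  have [xy yp] := UC yU.
  apply: (IH (l * y :: vs)) => //=; last by lia.
    split=> //.
      rewrite (invM invs) (inK_sym invs sx lK) -(inK_comm lK (inv_comm invs sx xy)).
      rewrite mulrA -(mulrA l) -(inK_comm lK (inv_comm invs sx xy)) -!mulrA ek.
      by rewrite !mulrA -(mulrA l) lk mulr1 lk mul1r.
    move=> u uvs; rewrite (invM invs) (inK_sym invs sx lK).
    have [xu up] := UC (vU _ uvs).
    by rewrite -mulrA (inK_comm lK xu) mulrA (sform0 (yo _ uvs)) mul0r.
  by move=> v; rewrite inE => /orP[/eqP ->|/vU //]; apply: UK.
move=> alt'; have alt y' : U y' -> (forall v, v \in vs -> s v * y' = 0) -> s y' * y' = 0.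
  by move=> y'U y'o; apply: NNPP => n; apply: alt'; exists y'.
(* Subtracting from z0 its projection onto the family keeps its pairing with y, which is orthogonal
   to the family. *)
have [z0 z0U yz0] := Und yU yn0.
pose z := z0 + famproj vs * z0.
have zU : U z by apply: UD => //; apply: proj_in.
have zo v : v \in vs -> s v * z = 0 by apply: ortho_proj.
have yz : s y * z = p.
  rewrite mulrDr yz0 [X in p + X](_ : _ = 0) ?addr0 //.
  rewrite /famproj mulr_suml mulr_sumr big_seq big1 // => v vvs.
  by rewrite !mulrA (sform0 (yo _ vvs)) !mul0r.
have zy : s z * y = p by rewrite -[y](invK invs) -(invM invs) yz sp.
have yy := alt _ yU yo; have zz := alt _ zU zo.
clear alt alt' yz0 yn0; move: y z yU zU yo zo yz zy yy zz => {y0 y0U y0n z0 z0U}y z.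
case: vs ovs vU vs0 szvs => // v vs [vv vu ovs] vU _ szvs yU zU yo zo yz zy yy zz.
have vy : s v * y = 0 by apply: yo; rewrite inE eqxx.
have vz : s v * z = 0 by apply: zo; rewrite inE eqxx.
have yv := sform0 vy; have zv := sform0 vz.
have uo u : u \in vs -> [/\ s v * u = 0, s y * u = 0 & s z * u = 0].
  by move=> uvs; split; [apply: vu|apply/sform0/yo|apply/sform0/zo]; rewrite // inE uvs orbT.
have vU1 : U v by apply: vU; rewrite inE eqxx.
apply: (IH [:: v + y, v + z, v + y + z & vs]) => //=; last by move: szvs => /=; lia.
  rewrite !linearD /=; split.
  - by rewrite mulrDl !mulrDr vv vy yv yy !addr0.
  - move=> u; rewrite !inE => /or3P[/eqP ->|/eqP ->|/uo[e1 e2 e3]].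
    + by rewrite mulrDl !mulrDr vv vz yv yz addr0 add0r (addvv2 char2).
    + by rewrite mulrDl !mulrDr vv vy vz yv yy yz !addr0 add0r (addvv2 char2).
    + by rewrite mulrDl e1 e2 addr0.
  split.
  - by rewrite mulrDl !mulrDr vv vz zv zz !addr0.
  - move=> u; rewrite !inE => /orP[/eqP ->|/uo[e1 e2 e3]].
    + by rewrite mulrDl !mulrDr vv vy vz zv zy zz !addr0 add0r (addvv2 char2).
    + by rewrite mulrDl e1 e3 addr0.
  split=> //.
  - rewrite !mulrDl !mulrDr vv vy vz yv yy yz zv zy zz !addr0 !add0r.
    by rewrite -addrA (addvv2 char2) addr0.
  - by move=> u /uo[e1 e2 e3]; rewrite !mulrDl e1 e2 e3 !addr0.
move=> u; rewrite !inE => /or4P[/eqP ->|/eqP ->|/eqP ->|uvs]; do ?apply: UD => //.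
by apply: vU; rewrite inE uvs orbT.
Qed.

End Basis.
End Orthonormal.

(** * The corner algebra p A p *)

Section Corner.
Variables (F : fieldType) (A : falgType F) (s : 'End(A)).
Hypotheses (char2 : 2%N \in [pchar F]) (invs : is_involution s).
Hypothesis csaA : is_csa_sub {:A}.
Variables (x : A) (c : F).
Hypotheses (xx : x * x = c%:A) (cns : ~ (exists d : F, c = d ^+ 2)) (sx : s x = x).
Variable p : A.
Hypotheses (pp : p * p = p) (xp : GRing.comm x p) (sp : s p = p) (p0 : p != 0).
Hypothesis (rp : rank_le1 x p).

Lemma corner_cent h : p * h * p = h -> GRing.comm x h -> exists2 k, inK x k & h = k * p.
Proof. by move=> php xh; rewrite -php; apply: rp. Qed.

(** The derivation y -> x y + y x is nonzero on p A p, since x p and p are independent. Its values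
    there that commute with x lie in K p, and an element of K scales a nonzero one to x p. *)
Lemma corner_ad : exists w, p * w * p = w /\ x * w + w * x = x * p.
Proof.
have [a ta] : exists a, x * (p * a * p) + (p * a * p) * x <> 0.
  apply: not_all_ex_not => h.
  have := csa_free_bimul csaA (s := [:: (x * p, p); (p, p * x)]).
  rewrite /= !memvf => /(_ isT (freeK char2 xx cns p0)) H.
  have : p = 0.
    apply: (H _ (x * p, p)); last by rewrite inE eqxx.
    by move=> z _; rewrite !big_cons big_nil addr0 /= !mulrA -(h z) !mulrA.
  by move/eqP; rewrite (negbTE p0).
have [pB Bp] : p * (p * a * p) = p * a * p /\ p * a * p * p = p * a * p.
  by rewrite !mulrA pp -!mulrA pp.
move: (p * a * p) ta pB Bp => B ta pB Bp.
have [|k kK ek] := @corner_cent _ _ (comm_ad xx B).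
  rewrite mulrDr mulrDl !mulrA -xp -(mulrA x p B) pB -(mulrA x B p) Bp.
  by rewrite -mulrA xp mulrA Bp.
have k0 : k != 0 by apply/eqP => k0; apply: ta; rewrite ek k0 mul0r.
have [l [lK kl lk]] := inK_inv char2 xx cns kK k0.
have xlK : inK x (x * l) by apply: (inKM xx) => //; apply: inKx.
exists (x * l * B); split.
  by rewrite mulrA -(inK_comm xlK xp) -!mulrA Bp pB.
have xl := inK_commx lK; have -> : x * (x * l * B) + x * l * B * x = x * l * (x * B + B * x).
  by rewrite mulrDr !mulrA -(mulrA x l x) -xl !mulrA.
by rewrite ek mulrA -(mulrA x) lk mulr1.
Qed.

Section Basis.
Variables (T : finType) (v : T -> A).
Hypothesis vC : forall i, GRing.comm x (v i).
Hypothesis vp : forall i, v i * p = v i.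
Hypothesis vv : forall i j, s (v i) * v j = if i == j then p else 0.
Hypothesis v1 : \sum_i v i * s (v i) = 1.

Let psv i : p * s (v i) = s (v i).
Proof. by rewrite -{1}sp -(invM invs) vp. Qed.

Let svC i : GRing.comm x (s (v i)). Proof. exact: inv_comm. Qed.

(* The diagonal embedding of p A p when A is identified, through the
   orthonormal basis v, with the matrices over p A p. *)
Definition corner_ext h := \sum_i v i * h * s (v i).

Lemma corner_ext_row h i : p * h = h -> s (v i) * corner_ext h = h * s (v i).
Proof.
move=> ph; rewrite /corner_ext mulr_sumr (bigD1 i) //= !mulrA vv eqxx ph.
by rewrite big1 ?addr0 // => j ji; rewrite !mulrA vv eq_sym (negbTE ji) !mul0r.
Qed.

Lemma corner_extM h h' : p * h' = h' -> corner_ext h * corner_ext h' = corner_ext (h * h').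
Proof.
move=> ph'; rewrite {1}/corner_ext mulr_suml; apply: eq_bigr => i _.
by rewrite -mulrA corner_ext_row // !mulrA.
Qed.

Lemma corner_extD h h' : corner_ext (h + h') = corner_ext h + corner_ext h'.
Proof. by rewrite -big_split; apply: eq_bigr => i _; rewrite mulrDr mulrDl. Qed.

Lemma corner_extK k h : inK x k -> corner_ext (k * h) = k * corner_ext h.
Proof.
move=> kK; rewrite [RHS]mulr_sumr; apply: eq_bigr => i _.
by rewrite !mulrA (inK_comm kK (vC i)).
Qed.

Lemma corner_extp : corner_ext p = 1.
Proof. by rewrite -v1; apply: eq_bigr => i _; rewrite vp. Qed.

Lemma corner_ext_inv h : s (corner_ext h) = corner_ext (s h).
Proof.
rewrite linear_sum; apply: eq_bigr => i _ /=.
by rewrite !(invM invs) (invK invs) mulrA.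
Qed.

(** For w from [corner_ad], both w^2 + w and sigma(w) + w lie in p A p and commute with x, hence lie
    in K p. On the diagonal copy W of w this reads W^2 = W + k and sigma(W) = W + k', which give a
    quaternion subalgebra and its stability. *)
Lemma corner_quaternion : exists Q0 : {vspace A},
  [/\ is_quat_sub Q0, sigma_inv s Q0 & x \in Q0].
Proof.
have [w [pwp xw]] := corner_ad.
have pw : p * w = w by rewrite -pwp !mulrA pp.
have wp : w * p = w by rewrite -pwp -!mulrA pp.
have wx : w * x = x * w + x * p by apply: (eq_add2 char2); rewrite -xw; cancel2 char2.
have [||k kK ek] := @corner_cent (w * w + w).
- by rewrite mulrDr mulrDl mulrA pw -mulrA wp.
- rewrite /GRing.comm mulrDr mulrDl -[w * w * x]mulrA wx mulrDr !mulrA wx.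
  by rewrite !mulrDl -(mulrA x p w) pw -(mulrA x w p) wp -(mulrA x p p) pp; cancel2 char2.
have swE : p * s w * p = s w by rewrite -{2}pwp !(invM invs) sp mulrA.
have [||k' kK' ek'] := @corner_cent (s w + w).
- by rewrite mulrDr mulrDl swE pwp.
- have xsw : x * s w + s w * x = x * p.
    by move: (congr1 s xw); rewrite linearD /= !(invM invs) sx sp addrC xp.
  apply: (eq_add2 char2); rewrite mulrDr mulrDl addrACA xsw xw; exact: addvv2.
pose W := corner_ext w.
have xW : x * W + W * x = x.
  have -> : W * x = corner_ext (w * x).
    by rewrite mulr_suml; apply: eq_bigr => i _; rewrite -mulrA -svC !mulrA.
  by rewrite -(corner_extK _ (inKx x)) -corner_extD xw corner_extK ?corner_extp ?mulr1 //; apply: inKx.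
have WW : W * W = W + k.
  rewrite corner_extM // (_ : w * w = w + k * p); last first.
    by apply: (eq_add2 char2); rewrite -ek; cancel2 char2.
  by rewrite corner_extD corner_extK // corner_extp mulr1.
have sW : s W = W + k'.
  rewrite corner_ext_inv (_ : s w = w + k' * p); last first.
    by apply: (eq_add2 char2); rewrite -ek'; cancel2 char2.
  by rewrite corner_extD corner_extK // corner_extp mulr1.
have c0 : c != 0 by apply/eqP => c0; apply: cns; exists 0; rewrite c0 expr0n.
have Qq := quat_gen_quat char2 xx c0 xW WW kK.
have Kgen l : inK x l -> l \in quat_gen x W.
  move=> lK; apply/quat_genP; exists l, 0; rewrite mul0r addr0; split=> //; exact: inK0.
have csaQ : is_csa_sub (quat_gen x W) by case: Qq.
exists (quat_gen x W); split=> //; last by apply: Kgen; apply: inKx.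
apply/subvP => _ /memv_imgP[y /quat_genP[l [m [lK mK ->]]] ->].
rewrite linearD /= (invM invs) (inK_sym invs sx lK) (inK_sym invs sx mK) sW.
apply: memvD; first exact: Kgen.
apply: (csa_memM csaQ); last exact: Kgen.
by apply/quat_genP; exists k', 1; rewrite mul1r addrC; split=> //; apply: inK1.
Qed.

End Basis.
End Corner.

Lemma dim_span_family (F : fieldType) (V : vectType F) (I : finType) (b : I -> V) :
  (forall k : I -> F, \sum_i k i *: b i = 0 -> forall i, k i = 0) ->
  \dim <<codom b>> = #|I|.
Proof.
move=> h; rewrite -(size_codom b); apply/eqP; suff: free (codom_tuple b) by [].
apply/freeP => k e i.
rewrite -[i]enum_valK; apply: (h (fun j => k (enum_rank j))).
rewrite -[RHS]e (reindex (fun j : 'I_#|I| => enum_val j)) /=; last exact/onW_bij/enum_val_bij.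
by apply: eq_bigr => j _; rewrite enum_valK nth_codom.
Qed.

Lemma sum_sqr_comm (R : pzRingType) (T : Type) (r : seq T) (a : T -> R) :
  (forall y : R, y + y = 0) -> (forall i j, a i * a j = a j * a i) ->
  (\sum_(i <- r) a i) * (\sum_(i <- r) a i) = \sum_(i <- r) a i * a i.
Proof.
move=> h2 aC; elim: r => [|i r IH]; first by rewrite !big_nil mulr0.
rewrite !big_cons mulrDl !mulrDr IH.
have -> : a i * (\sum_(j <- r) a j) = (\sum_(j <- r) a j) * a i.
  by rewrite mulr_sumr mulr_suml; apply: eq_bigr => j _; rewrite aC.
by rewrite -addrA [X in _ + X]addrA h2 add0r.
Qed.

(** * The dimension of A from an orthonormal basis *)

Section Grid.
Variables (F : fieldType) (A : falgType F) (s : 'End(A)).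
Hypotheses (char2 : 2%N \in [pchar F]) (invs : is_involution s).
Hypothesis csaA : is_csa_sub {:A}.
Variables (x : A) (c : F).
Hypotheses (xx : x * x = c%:A) (cns : ~ (exists d : F, c = d ^+ 2)) (sx : s x = x).
Variable p : A.
Hypotheses (pp : p * p = p) (xp : GRing.comm x p) (sp : s p = p) (p0 : p != 0).
Hypothesis (rp : rank_le1 x p).

Lemma inK_eq0r (k y : A) : inK x k -> y != 0 -> k * y = 0 -> k = 0.
Proof.
move=> kK y0 /(inK_cancel char2 xx cns kK) [] // e.
by rewrite e eqxx in y0.
Qed.

Section Dimension.
Variables (T : finType) (v : T -> A).
Hypothesis vC : forall i, GRing.comm x (v i).
Hypothesis vp : forall i, v i * p = v i.
Hypothesis vv : forall i j, s (v i) * v j = if i == j then p else 0.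
Hypothesis v1 : \sum_i v i * s (v i) = 1.

(** The elements v_i h sigma(v_j), with h in the basis p, x p, w, x w of p A p, form a basis of
    [A]. *)
Lemma grid_dim : \dim {:A} = (4 * #|T| ^ 2)%N.
Proof.
have [w [pwp xw]] := corner_ad char2 csaA xx cns pp xp p0 rp.
have pw : p * w = w by rewrite -pwp !mulrA pp.
have wp : w * p = w by rewrite -pwp -!mulrA pp.
have psv i : p * s (v i) = s (v i) by rewrite -{1}sp -(invM invs) vp.
pose h (q : 'I_4) := [tuple p; x * p; w; x * w]`_q.
have php q : p * h q * p = h q.
  rewrite /h; case: q => [[|[|[|[|//]]]] ?] /=.
  - by rewrite pp.
  - by rewrite mulrA -xp -!mulrA pp pp.
  - exact: pwp.
  - by rewrite mulrA -xp -!mulrA wp pw.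
have h_free (k : 'I_4 -> F) : \sum_q k q *: h q = 0 -> forall q, k q = 0.
  rewrite !big_ord_recl big_ord0 addr0 /h /= => e.
  pose k1 := (k ord0)%:A + k (lift ord0 ord0) *: x.
  pose k2 := (k (lift ord0 (lift ord0 ord0)))%:A + k (lift ord0 (lift ord0 (lift ord0 ord0))) *: x.
  have k1K : inK x k1 by exists (k ord0), (k (lift ord0 ord0)).
  have k2K : inK x k2.
    by exists (k (lift ord0 (lift ord0 ord0))), (k (lift ord0 (lift ord0 (lift ord0 ord0)))).
  have {}e : k1 * p + k2 * w = 0.
    by rewrite -[RHS]e /k1 /k2 !mulrDl -!scalerAl !mul1r !addrA.
  have k1E : k1 = 0 -> k ord0 = 0 /\ k (lift ord0 ord0) = 0.
    exact: (inK_eq0 char2 xx cns).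
  have k2E : k2 = 0 ->
      k (lift ord0 (lift ord0 ord0)) = 0 /\ k (lift ord0 (lift ord0 (lift ord0 ord0))) = 0.
    exact: (inK_eq0 char2 xx cns).
  clearbody k1 k2; have k20 : k2 = 0.
    have E : k2 * (x * w + w * x) = x * (k1 * p + k2 * w) + (k1 * p + k2 * w) * x.
      rewrite !mulrDr !mulrDl !mulrA (inK_commx k1K) (inK_commx k2K).
      by rewrite -(mulrA k1 x p) xp mulrA; cancel2 char2.
    move: E; rewrite xw e mulr0 mul0r addr0; apply: inK_eq0r => //.
    apply: contraNneq p0 => xp0; have := inK_cancel char2 xx cns (inKx x) xp0.
    case=> [x0|->] //; case: cns; exists 0; move/eqP: xx; rewrite x0 mul0r eq_sym scaler_eq0.
    by rewrite oner_eq0 orbF expr0n => /eqP.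
  have k10 : k1 = 0.
    by apply: (inK_eq0r k1K p0); move: e; rewrite k20 mul0r addr0.
  have [e0 e1] := k1E k10; have [e2 e3] := k2E k20.
  move=> q; case: (unliftP ord0 q) => [j|] -> //.
  case: (unliftP ord0 j) => [l|] -> //.
  by case: (unliftP ord0 l) => [r|] ->; rewrite ?ord1.
pose b (t : T * T * 'I_4) := v t.1.1 * h t.2 * s (v t.1.2).
have -> : (fullv : {vspace A}) = <<codom b>>%VS.
  apply/eqP; rewrite eqEsubv subvf andbT; apply/subvP => y _.
  have -> : y = \sum_i \sum_j v i * (s (v i) * y * v j) * s (v j).
    rewrite -[LHS]mulr1 -[LHS]mul1r -v1 mulr_suml; apply: eq_bigr => i _.
    by rewrite !mulr_sumr; apply: eq_bigr => j _; rewrite !mulrA.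
  apply: memv_suml => i _; apply: memv_suml => j _.
  set g := s (v i) * y * v j.
  have pgp : p * g * p = g by rewrite /g !mulrA psv -!mulrA vp.
  have pg : p * g = g by rewrite -pgp !mulrA pp.
  have gp : g * p = g by rewrite -pgp -!mulrA pp.
  clearbody g.
  have [|k kK ek] := corner_cent rp _ (comm_ad xx g).
    by rewrite mulrDr mulrDl !mulrA -xp -(mulrA x p) pg -(mulrA x g) gp -(mulrA g x) xp mulrA gp.
  (* With l x = k the element g + l w commutes with x, because x g + g x = k p = l (x w + w x). *)
  have [l lK lx] : exists2 l, inK x l & l * x = k.
    exists (c^-1 *: (k * x)); first by apply: inKZ; apply: (inKM xx) => //; apply: inKx.
    rewrite -scalerAl -mulrA xx -scalerAr mulr1 scalerA mulVf ?scale1r //.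
    by apply/eqP => c0; apply: cns; exists 0; rewrite c0 expr0n.
  have xl := inK_commx lK.
  have [||m mK em] := corner_cent rp (h := g + l * w).
  - by rewrite mulrDr mulrDl pgp mulrA -(inK_comm lK xp) -!mulrA wp pw.
  - apply: (eq_add2 char2).
    have -> : x * (g + l * w) + (g + l * w) * x = (x * g + g * x) + l * (x * w + w * x).
      by rewrite !mulrDr !mulrDl !mulrA xl; cancel2 char2.
    by rewrite ek xw mulrA lx addvv2.
  have -> : g = m * p + l * w by rewrite -em -addrA addvv2 ?addr0.
  case: mK lK {em xl lx} => m0 [m1 ->] [l0 [l1 ->]].
  have memb q : v i * h q * s (v j) \in <<codom b>>%VS.
    by apply: memv_span; apply: (codom_f b (i, j, q)).
  rewrite !mulrDl -!scalerAl !mul1r !mulrDr !mulrDl -!scalerAr -!scalerAl.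
  do ![apply: memvD]; apply: memvZ.
  - exact: (memb ord0).
  - exact: (memb (lift ord0 ord0)).
  - exact: (memb (lift ord0 (lift ord0 ord0))).
  - exact: (memb (lift ord0 (lift ord0 (lift ord0 ord0)))).
rewrite dim_span_family ?card_prod ?card_ord; first by rewrite mulnC mulnn.
move=> k e [[i j] q]; apply: (h_free (fun q => k (i, j, q))).
have := congr1 (fun y => s (v i) * y * v j) e; rewrite mulr0 mul0r => E.
rewrite -[RHS]E mulr_sumr mulr_suml.
pose G (ij : T * T) q := if ij == (i, j) then k (ij, q) *: h q else 0.
rewrite [RHS](eq_bigr (fun t => G t.1 t.2)); last first.
  move=> [[i' j'] q'] _ /=; rewrite -scalerAr -scalerAl /b /G /= !mulrA vv -!mulrA vv xpair_eqE.
  rewrite [i' == i]eq_sym; case: (i == i') => /=; last by rewrite mul0r scaler0.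
  case: (j' == j); last by rewrite !mulr0 scaler0.
  by rewrite mulrA php.
rewrite -(pair_bigA _ G) /= [RHS](bigD1 (i, j)) //= [X in _ = _ + X]big1 ?addr0.
  by apply: eq_bigr => q' _; rewrite /G eqxx.
by move=> ij ne; rewrite big1 // => q' _; rewrite /G (negbTE ne).
Qed.

End Dimension.
End Grid.

(** * An inseparable subalgebra from an orthonormal basis *)

Section Inseparable.
Variables (F : fieldType) (A : falgType F) (s : 'End(A)).
Hypotheses (char2 : 2%N \in [pchar F]) (invs : is_involution s).
Variables (x : A) (c : F).
Hypotheses (xx : x * x = c%:A) (cns : ~ (exists d : F, c = d ^+ 2)) (sx : s x = x).
Variable p : A.
Hypotheses (p0 : p != 0) (rp : rank_le1 x p).
Variable m : nat.
Let T := 'rV['F_2]_m.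
Variable v : T -> A.
Hypothesis vC : forall i, GRing.comm x (v i).
Hypothesis vp : forall i, v i * p = v i.
Hypothesis vv : forall i j, s (v i) * v j = if i == j then p else 0.
Hypothesis v1 : \sum_i v i * s (v i) = 1.
Hypothesis sp : s p = p.

Let addtt (t : T) : t + t = 0.
Proof.
by apply/rowP => j; rewrite !mxE; case: (t 0 j) => [[|[|//]] ?]; apply: val_inj.
Qed.

Let addKt (t u : T) : u + t + t = u.
Proof. by rewrite -addrA addtt addr0. Qed.

(* The permutation matrix of the translation by t. *)
Definition shift (t : T) := \sum_i v i * s (v (i + t)).

Lemma shift_vec t j : shift t * v j = v (j + t).
Proof.
rewrite /shift mulr_suml (bigD1 (j + t)) //= -mulrA vv addKt eqxx vp big1 ?addr0 // => i ij.
rewrite -mulrA vv (_ : (i + t == j) = false) ?mulr0 //.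
by apply: contraNF ij => /eqP <-; rewrite addKt.
Qed.

Lemma eq_on_basis y z : (forall i, y * v i = z * v i) -> y = z.
Proof.
move=> yz; rewrite -[y]mulr1 -[z]mulr1 -v1 !mulr_sumr.
by apply: eq_bigr => i _; rewrite !mulrA yz.
Qed.

Lemma shiftM t u : shift t * shift u = shift (t + u).
Proof.
by apply: eq_on_basis => i; rewrite -mulrA !shift_vec -addrA [u + t]addrC.
Qed.

Lemma shift0 : shift 0 = 1.
Proof. by apply: eq_on_basis => i; rewrite shift_vec addr0 mul1r. Qed.

Lemma shift_sym t : s (shift t) = shift t.
Proof.
rewrite /shift linear_sum /= (reindex_inj (addIr t)) /=; apply: eq_bigr => i _.
by rewrite (invM invs) (invK invs) addKt.
Qed.

Lemma shift_comm t : GRing.comm x (shift t).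
Proof.
rewrite /GRing.comm /shift mulr_sumr mulr_suml; apply: eq_bigr => i _.
by rewrite -mulrA -(inv_comm invs sx (vC _)) !mulrA vC.
Qed.

Definition shift_gen (tb : T * bool) := if tb.2 then x * shift tb.1 else shift tb.1.
Definition shift_alg := <<codom shift_gen>>%VS.

Lemma shift_algP y : y \in shift_alg <->
  exists2 k : T -> A, forall t, inK x (k t) & y = \sum_t k t * shift t.
Proof.
split=> [|[k kK ->]]; last first.
  apply: memv_suml => t _; have [f [g ->]] := kK t.
  rewrite mulrDl -!scalerAl mul1r; apply: memvD; apply: memvZ; apply: memv_span.
    exact: (codom_f shift_gen (t, false)).
  exact: (codom_f shift_gen (t, true)).
move=> /(@coord_span _ _ _ (codom_tuple shift_gen)) ->.
apply: (big_ind (fun y => exists2 k : T -> A, forall t, inK x (k t) & y = \sum_t k t * shift t)).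
- by exists (fun=> 0) => [t|]; [exact: inK0|rewrite big1 // => t _; rewrite mul0r].
- move=> _ _ [k kK ->] [l lK ->]; exists (fun t => k t + l t) => [t|]; first exact: inKD.
  by rewrite -big_split; apply: eq_bigr => t _; rewrite mulrDl.
move=> i _; rewrite nth_codom; case: (enum_val i) => t b; set f := coord _ _ _.
have [k kK ->] : exists2 k, inK x k & shift_gen (t, b) = k * shift t.
  by case: b; [exists x => //; exact: inKx|exists 1; [exact: inK1|rewrite mul1r]].
exists (fun u => if u == t then f *: k else 0) => [u|].
  by case: (u == t); [exact: inKZ|exact: inK0].
by rewrite (bigD1 t) //= eqxx -scalerAl big1 ?addr0 // => u /negbTE ->; rewrite mul0r.
Qed.

Lemma shift_alg_mem k t : inK x k -> k * shift t \in shift_alg.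
Proof.
move=> kK; apply/shift_algP; exists (fun u => if u == t then k else 0) => [u|].
  by case: (u == t) => //; exact: inK0.
by rewrite (bigD1 t) //= eqxx big1 ?addr0 // => u /negbTE ->; rewrite mul0r.
Qed.

Lemma shift_algM y z : y \in shift_alg -> z \in shift_alg -> y * z \in shift_alg.
Proof.
move=> /shift_algP[k kK ->] /shift_algP[l lK ->].
rewrite mulr_suml; apply: memv_suml => t _; rewrite mulr_sumr; apply: memv_suml => u _.
have -> : k t * shift t * (l u * shift u) = k t * l u * shift (t + u).
  by rewrite -shiftM !mulrA -(mulrA _ (shift t)) -(inK_comm (lK u) (shift_comm t)) !mulrA.
by apply: shift_alg_mem; apply: (inKM xx).
Qed.

(** In a sum y of terms l_t [shift t] with l_t in K, the coefficient is recovered from sigma(v_t) y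
    v_0 = l_t p. *)
Lemma shift_alg_dim : \dim shift_alg = (2 * 2 ^ m)%N.
Proof.
rewrite dim_span_family ?card_prod ?card_bool ?card_mx ?card_ord; first by rewrite mul1n mulnC.
move=> k e [t b].
pose l u := (k (u, false))%:A + k (u, true) *: x.
have lK u : inK x (l u) by exists (k (u, false)), (k (u, true)).
have {}e : \sum_u l u * shift u = 0.
  rewrite -[RHS]e; transitivity (\sum_u \sum_b' k (u, b') *: shift_gen (u, b')); last first.
    by rewrite (pair_bigA _ (fun u b' => k (u, b') *: shift_gen (u, b'))); apply: eq_bigr => -[].
  apply: eq_bigr => u _; rewrite /l mulrDl -!scalerAl mul1r (bigD1 false) //=.
  rewrite (bigD1 true) //= big1 ?addr0 //= => -[] //.
have lt0 : l t = 0.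
  apply: (inK_eq0r char2 xx cns (lK t) p0).
  have := congr1 (fun y => s (v t) * y * v 0) e; rewrite mulr0 mul0r => E; rewrite -[RHS]E.
  rewrite mulr_sumr mulr_suml (bigD1 t) //= big1 ?addr0.
    rewrite mulrA -(inK_comm (lK t) (inv_comm invs sx (vC t))) -!mulrA shift_vec add0r.
    by rewrite vv eqxx.
  move=> u ut; rewrite mulrA -(inK_comm (lK u) (inv_comm invs sx (vC t))) -!mulrA shift_vec add0r.
  by rewrite vv eq_sym (negbTE ut) mulr0.
have [f0 f1] := inK_eq0 char2 xx cns lt0.
by case: b.
Qed.

Lemma shift_alg_x : x \in shift_alg.
Proof. by rewrite -[x]mulr1 -shift0; apply: shift_alg_mem; apply: inKx. Qed.

(** The translations commute and square to 1, so in characteristic two the square of a sum of terms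
    k_t [shift t] is the sum of the scalars k_t^2. *)
Lemma shift_alg_sym_plus y : y \in shift_alg -> sym_plus s y.
Proof.
move=> /shift_algP[k kK ->]; split.
  rewrite linear_sum /=; apply: eq_bigr => t _.
  by rewrite (invM invs) shift_sym (inK_sym invs sx (kK t)) (inK_comm (kK t) (shift_comm t)).
have com t u : k t * shift t * (k u * shift u) = k t * k u * shift (t + u).
  by rewrite -shiftM !mulrA -(mulrA _ (shift t)) -(inK_comm (kK u) (shift_comm t)) !mulrA.
rewrite sum_sqr_comm; last 2 first.
- exact: addvv2.
- by move=> t u; rewrite !com (inK_commK (kK t) (kK u)) addrC.
apply: (big_ind (fun y => exists f : F, y = f%:A)).
- by exists 0; rewrite scale0r.
- by move=> _ _ [f ->] [g ->]; exists (f + g); rewrite scalerDl.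
move=> t _; rewrite com addtt shift0 mulr1.
by have [f -> _] := inK_sq char2 xx (kK t); exists f.
Qed.

Lemma shift_alg_insep n : n = m.+1 -> is_insep_sub s n shift_alg.
Proof.
move=> ->.
have one : 1 \in shift_alg by rewrite -shift0 -[shift 0]mul1r shift_alg_mem //; apply: inK1.
have gt t : shift t \in shift_alg by rewrite -[shift t]mul1r shift_alg_mem //; apply: inK1.
split.
- by split=> //; apply/prodvP => y z; apply: shift_algM.
- by rewrite shift_alg_dim expnS.
- exact: shift_alg_sym_plus.
- apply/eqP; rewrite eqEsubv; apply/andP; split; last first.
    apply/centvsP => y z yS zS; have [<- _] := shift_alg_sym_plus (shift_algM yS zS).
    by rewrite (invM invs); have [-> _] := shift_alg_sym_plus yS; have [-> _] := shift_alg_sym_plus zS.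
  (* An element commuting with all translations is determined by its product with v_0, since v_j =
     [shift j] v_0. The K-coordinates of y v_0 therefore define an element of the algebra that
     equals y. *)
  apply/subvP => y /centvP yC.
  have xy : GRing.comm x y by rewrite /GRing.comm yC // shift_alg_x.
  have psv t : p * s (v t) = s (v t) by rewrite -{1}sp -(invM invs) vp.
  have /fin_all_exists2[k kK ke] : forall t, exists2 k, inK x k & s (v t) * y * v 0 = k * p.
    move=> t; have [|k kK e] := rp (y := s (v t) * y * v 0).
      by do ?apply: commrM => //; apply: (inv_comm invs sx).
    by exists k => //; rewrite -e !mulrA psv -(mulrA _ (v 0)) vp.
  apply/shift_algP; exists k => //; apply: eq_on_basis => j.
  set z := \sum_t _.
  have y0 : y * v 0 = z * v 0.
    rewrite -[LHS]mul1r -v1 !mulr_suml; apply: eq_bigr => t _.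
    rewrite -!mulrA [s _ * _]mulrA ke shift_vec add0r mulrA -(inK_comm (kK t) (vC t)).
    by rewrite -mulrA vp.
  have zC : z * shift j = shift j * z.
    rewrite /z mulr_suml mulr_sumr; apply: eq_bigr => t _.
    by rewrite mulrA -(inK_comm (kK t) (shift_comm j)) -!mulrA !shiftM addrC.
  by rewrite -[j]add0r -shift_vec !mulrA yC // zC -!mulrA y0.
(* The generators are x and the translations by the m unit vectors. *)
pose gens (i : 'I_m.+1) := if unlift ord0 i is Some j then shift (delta_mx 0 j) else x.
exists gens; apply/eqP; rewrite eqEsubv; apply/andP; split.
  apply: agenv_sub_modl; first by rewrite -memvE.
  apply/prodvP => y z yG; apply: shift_algM.
  apply: (subvP _ _ yG); apply/subv_sumP => i _; rewrite -memvE /gens.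
  by case: unlift => [j|]; [apply: gt|apply: shift_alg_x].
set E := agenv _.
have genE i : gens i \in E.
  by apply: (subvP (sub_agenv _)); rewrite memvE (sumv_sup i).
have E1 : 1 \in E by rewrite memvE sub1_agenv.
have EM y z : y \in E -> z \in E -> y * z \in E.
  by move=> yE zE; rewrite /E -agenvM memv_mul.
have xE : x \in E by have := genE ord0; rewrite /gens unlift_none.
have shE t : shift t \in E.
  rewrite [t]row_sum_delta; apply: (big_ind (fun u => shift u \in E)) => [|t1 t2 h1 h2|j _].
    by rewrite shift0.
    by rewrite -shiftM EM.
  case: (t 0 j) => [[|[|//]] i].
    by rewrite (_ : Ordinal i = 0) ?scale0r ?shift0 //; apply: val_inj.
  rewrite (_ : Ordinal i = 1) ?scale1r; last exact: val_inj.
  by have := genE (lift ord0 j); rewrite /gens liftK.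
apply/span_subvP => _ /codomP[[t b] ->]; rewrite /shift_gen /=.
by case: b; rewrite ?EM ?shE.
Qed.

End Inseparable.

(** * Pfister forms of maximal index below the dimension *)

Section PfisterIndex.
Variable F : fieldType.
Hypothesis char2 : 2%N \in [pchar F].

Definition diag_form m (M : 'M[F]_m) := forall i j, i != j -> M i j = 0.

(** Each diagonal entry of P M P^T is a sum of squares times diagonal entries of M. This lets the
    slots of isometric Pfister forms be compared. *)
Lemma bf_isometric_inL m q (M : 'M[F]_m) (N : 'M[F]_q) c : bf_isometric M N ->
  diag_form M -> (forall k, inL c (M k k)) -> forall l, inL c (N l l).
Proof.
move=> [_ [P [_ <-]]] dM ML l; rewrite mxE.
apply: (big_ind (inL c)); [exact: inL0|by move=> *; apply: inLD|move=> k _].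
rewrite !mxE (bigD1 k) //= big1 ?addr0; last first.
  by move=> j jk; rewrite dM // mulr0.
rewrite mulrAC -expr2; apply: inLM => //; exact: inL_sq.
Qed.

Lemma diag_quad m (M : 'M[F]_m) (v : 'rV[F]_m) : diag_form M ->
  (v *m M *m v^T) 0 0 = \sum_k v 0 k ^+ 2 * M k k.
Proof.
move=> dM; rewrite mxE; apply: eq_bigr => k _; rewrite !mxE (bigD1 k) //= big1 ?addr0.
  by rewrite expr2 mulrAC.
by move=> i ik; rewrite dM // mulr0.
Qed.

Lemma bf_isometric_sym m q (M : 'M[F]_m) (N : 'M[F]_q) :
  bf_isometric M N -> bf_isometric N M.
Proof.
move=> [e]; case: q / e N => N [P [rP <-]]; split=> //.
have uP : P \in unitmx by rewrite -row_free_unit /row_free rP.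
exists (invmx P); split; first by apply/mxrank_unit; rewrite unitmx_inv.
by rewrite !mulmxA mulVmx // mul1mx -mulmxA -trmx_mul mulVmx // trmx1 mulmx1.
Qed.

Lemma pfister_diag (t : seq F) : diag_form (pfister t).
Proof. by move=> i j ij; rewrite mxE (negbTE ij). Qed.

Lemma pfister_inL c (t : seq F) : (forall a, a \in t -> inL c a) ->
  forall k, inL c (pfister t k k).
Proof.
move=> tL k; rewrite mxE eqxx; apply: (big_ind (inL c)); first exact: inL1.
  by move=> *; apply: inLM.
by move=> i _; apply: tL; apply: mem_nth.
Qed.

(** In the index 2^i only bit i is set, so the product has the single factor number i. *)
Lemma pfister_slot (t : seq F) i : (i < size t)%N ->
  exists k, pfister t k k = t`_i.
Proof.
move=> it; have kt : (2 ^ i < 2 ^ size t)%N by rewrite ltn_exp2l.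
exists (Ordinal kt); rewrite mxE eqxx (bigD1 (Ordinal it)) /=; last by rewrite divnn expn_gt0.
rewrite big1 ?mulr1 // => j /andP[oj ji]; move: oj.
have [ij|ij] := ltnP i j; first by rewrite divn_small // ltn_exp2l.
have {}ij : (j < i)%N.
  by rewrite ltn_neqAle ij andbT; apply: contraNneq ji => e; apply/eqP/val_inj.
by rewrite -expnB ?(ltnW ij) // oddX subn_eq0 leqNgt ij.
Qed.

Lemma inL_square (f : F) : inL 0 f <-> exists d, f = d ^+ 2.
Proof.
split=> [[r [t ->]]|[d ->]]; last exact: inL_sq.
by exists r; rewrite mulr0 addr0.
Qed.

Lemma pfister1_nonsquare (b : F) : bf_anisotropic (pfister [:: b]) -> ~ (exists d, b = d ^+ 2).
Proof.
move=> an [d bd].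
(* If b = d^2, the vector (d, 1) is isotropic: its value is d^2 + b = 0. *)
pose v := \row_(k < 2 ^ size [:: b]) (if k == 0 :> nat then d else 1) : 'rV[F]_(2 ^ size [:: b]).
have /rowP/(_ (@Ordinal (2 ^ 1) 1 isT)) : v = 0.
  apply: an; apply/matrixP => i j; rewrite !ord1 diag_quad; last exact: pfister_diag.
  rewrite !big_ord_recl big_ord0 !mxE /=; do 2! rewrite big_mkcond big_ord_recl big_ord0 /=.
  by rewrite !mulr1 expr1n mul1r bd addr0 (addrr_pchar2 char2).
by rewrite !mxE /= => /eqP; rewrite oner_eq0.
Qed.

(** By dimension the anisotropic factor has a single slot b, so all alpha_j lie in F^2(b). They are
    not all squares, since otherwise b would be one, and a non-square among them generates F^2(b) by
    exchange. *)
Lemma pf_index_inL n (alpha : 'I_n -> F) : (0 < n)%N ->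
  pf_index [seq alpha i | i <- enum 'I_n] n.-1 ->
  exists2 i0, ~ (exists d, alpha i0 = d ^+ 2) & forall j, inL (alpha i0) (alpha j).
Proof.
move=> n0 [be [anb iso]]; have [sz _] := iso.
have {}sz : size be = 1%N.
  move/eqP: sz; rewrite eqn_exp2l // size_cat size_nseq size_map size_enum_ord; lia.
case: be sz anb iso => [|b [|//]] // _ anb iso.
have bns := pfister1_nonsquare anb.
have alb j : inL b (alpha j).
  have jn : (j < size [seq alpha i | i <- enum 'I_n])%N by rewrite size_map size_enum_ord.
  have [k ek] := pfister_slot jn.
  rewrite (nth_map j) ?size_enum_ord // nth_ord_enum in ek.
  rewrite -ek; apply: (bf_isometric_inL (bf_isometric_sym iso)); first exact: pfister_diag.
  apply: pfister_inL => a; rewrite mem_cat mem_nseq inE => /orP[/andP[_ /eqP ->]|/eqP ->].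
    exact: inL1.
  exact: inL_gen.
have [i0 i0ns] : exists i0, ~ (exists d, alpha i0 = d ^+ 2).
  apply: not_all_ex_not => all_sq; apply/bns/inL_square.
  have bn : (n.-1 < size (nseq n.-1 (1%R : F) ++ [:: b]))%N by rewrite size_cat size_nseq addn1.
  have [k ek] := pfister_slot bn.
  rewrite nth_cat size_nseq ltnn subnn /= in ek; rewrite -ek.
  apply: (bf_isometric_inL iso); first exact: pfister_diag.
  by apply: pfister_inL => _ /mapP[i _ ->]; apply/inL_square.
exists i0 => // j; apply: (inL_trans char2 _ (alb j)); exact: inL_exchange.
Qed.

End PfisterIndex.

(** * Totally decomposable involutions *)

Section Generators.
Variables (F : fieldType) (A : falgType F) (s : 'End(A)).
Hypotheses (char2 : 2%N \in [pchar F]) (invs : is_involution s) (orth : orthogonal_char2 s).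

Definition quat_gens (B : {vspace A}) (al : F) (uw : A * A) : Prop :=
  let: (u, w) := uw in
  [/\ [/\ u \in B, w \in B & al != 0],
      [/\ s u = u, s w = w & symd s u],
      [/\ u * u = al%:A, u * w + w * u = u & exists a : F, w * w = w + a%:A] &
      forall y, y \in B -> exists k l, [/\ inK u k, inK u l & y = k + l * w]].

Lemma symd_nonscalar u (f : F) : symd s u -> u != 0 -> u <> f%:A.
Proof.
by move=> us /negP u0 uf; apply: u0; move: us; rewrite uf => /(symd_scal orth) ->; rewrite scale0r.
Qed.

(** Here u comes from the discriminant and w from [quat_ad]. The element w + sigma(w) commutes with
    u, so it is some f + g u, and f = g = 0 because a symmetrized scalar is zero. The element w^2 +
    w commutes with u and with w, so it is a scalar. *)
Lemma quat_gens_exist B al : is_quat_sub B -> sigma_inv s B -> disc_rep s B al ->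
  exists uw, quat_gens B al uw.
Proof.
move=> qB sB [al0 [u [[q qB' uq] u0 uu]]].
have BM y z : y \in B -> z \in B -> y * z \in B by apply: csa_memM; case: qB.
have Bs y : y \in B -> s y \in B by move=> yB; apply: (subvP sB); apply: memv_img.
have us : symd s u by exists q.
have uB : u \in B by rewrite uq memvD // Bs.
have uF : ~ (exists f : F, u = f%:A) by case=> f; apply: symd_nonscalar.
have su : s u = u by apply: symd_sym us.
have [w wB uw] := quat_ad char2 qB uB uu uF.
have wu : w * u = u * w + u by apply: (eq_add2 char2); rewrite -[X in _ + (_ + X)]uw; cancel2 char2.
have sw_comm : GRing.comm u (w + s w).
  have E := congr1 s uw; rewrite linearD /= !(invM invs) su in E.
  apply: (eq_add2 char2); rewrite mulrDr mulrDl.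
  by transitivity ((u * w + w * u) + (s w * u + u * s w)); [cancel2 char2|rewrite uw E addvv2].
have [f [g e]] := quat_cent char2 qB uB uu uF (memvD wB (Bs _ wB)) sw_comm.
have f0 : f = 0.
  apply: (symd_scal orth); rewrite -[_%:A](_ : w + s w + g *: u = _); last first.
    by rewrite e -addrA addvv2 // addr0.
  by apply: symdD; [exists w|apply: symdZ].
have g0 : g = 0.
  (* Since sigma(w) = w + g u, the symmetrized element u w + sigma(u w) + u is the scalar g
     alpha. *)
  have : symd s (g * al)%:A.
    rewrite -[_%:A](_ : (u * w + s (u * w)) + u = _); first by apply: symdD us; exists (u * w).
    have sw : s w = w + g *: u.
      by apply: (eq_add2 char2); rewrite addrA [s w + w]addrC e f0 scale0r add0r addvv2.
    rewrite (invM invs) su sw mulrDl wu -scalerAl uu scalerA; cancel2 char2.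
  by move/(symd_scal orth)/eqP; rewrite mulf_eq0 (negbTE al0) orbF => /eqP.
have sw : s w = w.
  by apply/esym/(eq_add2 char2); rewrite e f0 g0 !scale0r addr0.
have ww_comm : GRing.comm u (w * w + w).
  rewrite /GRing.comm mulrDr mulrDl -mulrA wu mulrDr !mulrA wu mulrDl; cancel2 char2.
have [a [b e2]] := quat_cent char2 qB uB uu uF (memvD (BM _ _ wB wB) wB) ww_comm.
have b0 : b = 0.
  have : b *: u = 0.
    have : w * (w * w + w) + (w * w + w) * w = 0.
      by rewrite mulrDr mulrDl !mulrA addvv2.
    rewrite e2 mulrDr mulrDl -!scalerAr -!scalerAl mulr1 mul1r => <-.
    by rewrite wu scalerDr; cancel2 char2.
  by move/eqP; rewrite scaler_eq0 (negbTE u0) orbF => /eqP.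
exists (u, w); split=> //; last by move=> y yB; apply: (quat_span char2 qB uB uu uF al0 wB uw yB).
split=> //; exists a; apply: (eq_add2 char2); rewrite addrA e2 b0 scale0r addr0 addvv2 //.
Qed.

End Generators.

Section Decomposition.
Variables (F : fieldType) (A : falgType F) (s : 'End(A)).
Hypotheses (char2 : 2%N \in [pchar F]) (invs : is_involution s) (orth : orthogonal_char2 s).
Variables (n : nat) (Q : 'I_n -> {vspace A}) (alpha : 'I_n -> F) (gen : 'I_n -> A * A).
Hypothesis QC : forall i j, i != j -> forall u v, u \in Q i -> v \in Q j -> u * v = v * u.
Hypothesis Qs : forall i y, y \in Q i -> s y \in Q i.
Hypothesis QM : forall i y z, y \in Q i -> z \in Q i -> y * z \in Q i.
Hypothesis Q1 : forall i, 1 \in Q i.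
Hypothesis Qgen : forall i, quat_gens s (Q i) (alpha i) (gen i).
Variable c : F.
Hypothesis alL : forall i, inL c (alpha i).

Let u i := (gen i).1.
Let w i := (gen i).2.

Lemma genP i : [/\ [/\ u i \in Q i, w i \in Q i & alpha i != 0],
      [/\ s (u i) = u i, s (w i) = w i & symd s (u i)],
      [/\ u i * u i = (alpha i)%:A, u i * w i + w i * u i = u i & exists a : F, w i * w i = w i + a%:A] &
      forall y, y \in Q i -> exists k l, [/\ inK (u i) k, inK (u i) l & y = k + l * w i]].
Proof. by have := Qgen i; rewrite /u /w; case: (gen i). Qed.

Let wu i : w i * u i = u i * w i + u i.
Proof.
have [_ _ [_ uw _] _] := genP i.
by apply: (eq_add2 char2); rewrite -[X in _ + (_ + X)]uw; cancel2 char2.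
Qed.

Definition cent_out (r : seq 'I_n) (y : A) :=
  forall j, j \notin r -> forall q, q \in Q j -> y * q = q * y.

Lemma cent_outM r y z : cent_out r y -> cent_out r z -> cent_out r (y * z).
Proof. by move=> yC zC j jr q qQ; rewrite -mulrA (zC j jr) // !mulrA (yC j jr). Qed.

Lemma cent_outD r y z : cent_out r y -> cent_out r z -> cent_out r (y + z).
Proof. by move=> yC zC j jr q qQ; rewrite mulrDl mulrDr (zC j jr) // (yC j jr). Qed.

Lemma cent_out_inv r y : cent_out r y -> cent_out r (s y).
Proof.
move=> yC j jr q qQ; rewrite -[q](invK invs) -!(invM invs) (yC j jr) //; exact: Qs.
Qed.

Lemma cent_out_cons i r y : cent_out r y -> cent_out (i :: r) y.
Proof. by move=> yC j; rewrite inE negb_or => /andP[_]; apply: yC. Qed.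

Lemma cent_out_Q i r y : y \in Q i -> cent_out (i :: r) y.
Proof.
move=> yQ j; rewrite inE negb_or eq_sym => /andP[ij _] q qQ.
exact: QC ij _ _ yQ qQ.
Qed.

Definition Qprod (r : seq 'I_n) : {vspace A} := \big[@prodv F A/1%VS]_(i <- r) Q i.

Lemma Qprod_cent r y : y \in Qprod r -> cent_out r y.
Proof.
elim: r y => [|i r IH] y; rewrite /Qprod ?big_nil ?big_cons.
  by move=> /vlineP[f ->] j _ q _; rewrite -scalerAl -scalerAr mul1r mulr1.
apply: prodv_ind => [|a b|a b aQ bQ]; first by move=> j _ q _; rewrite mul0r mulr0.
  exact: cent_outD.
by apply: cent_outM; [apply: cent_out_Q|apply: cent_out_cons; apply: IH].
Qed.

(* The F^2(c)-span of the products of the w_i ^ 2 for i in J, where J ranges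
   over the subsets of r. *)
Fixpoint norm_form (r : seq 'I_n) (y : A) : Prop :=
  if r is i :: r' then
    exists y0 y1, [/\ norm_form r' y0, norm_form r' y1 & y = y0 + y1 * (w i * w i)]
  else exists2 f, inL c f & y = f%:A.

Lemma norm_form0 r : norm_form r 0.
Proof.
elim: r => [|i r IH] /=; first by exists 0; [exact: inL0|rewrite scale0r].
by exists 0, 0; rewrite mul0r addr0.
Qed.

Lemma norm_formD r y z : norm_form r y -> norm_form r z -> norm_form r (y + z).
Proof.
elim: r y z => [|i r IH] y z /=.
  by move=> [f fL ->] [g gL ->]; exists (f + g); [exact: inLD|rewrite scalerDl].
move=> [y0 [y1 [h0 h1 ->]]] [z0 [z1 [k0 k1 ->]]].
by exists (y0 + z0), (y1 + z1); split; [exact: IH|exact: IH|rewrite mulrDl addrACA].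
Qed.

Lemma norm_formZ r f y : inL c f -> norm_form r y -> norm_form r (f *: y).
Proof.
move=> fL; elim: r y => [|i r IH] y /=.
  by move=> [g gL ->]; exists (f * g); [exact: inLM|rewrite scalerA].
move=> [y0 [y1 [h0 h1 ->]]]; exists (f *: y0), (f *: y1).
by split; [exact: IH|exact: IH|rewrite scalerDr scalerAl].
Qed.

Lemma norm_form_cent r y : norm_form r y -> cent_out r y.
Proof.
elim: r y => [|i r IH] y /=.
  by move=> [f _ ->] j _ q _; rewrite -scalerAl -scalerAr mul1r mulr1.
move=> [y0 [y1 [h0 h1 ->]]]; have [[_ wQ _] _ _ _] := genP i.
apply: cent_outD; [apply: cent_out_cons; exact: IH|apply: cent_outM].
  by apply: cent_out_cons; apply: IH.
by apply: cent_out_Q; apply: QM.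
Qed.

Lemma norm_form_sym r y : uniq r -> norm_form r y -> s y = y.
Proof.
elim: r y => [|i r IH] y /=; first by move=> _ [f _ ->]; rewrite linearZ /= (inv1 invs).
move=> /andP[ir ur] [y0 [y1 [h0 h1 ->]]]; have [[_ wQ _] [_ sw _] _ _] := genP i.
rewrite linearD /= !(invM invs) sw !IH //.
by rewrite (norm_form_cent h1 ir) ?QM.
Qed.

(* z |-> z + u z u / alpha removes the terms not involving w ^ 2. *)
Lemma symd_peel i z0 z1 : (forall q, q \in Q i -> z0 * q = q * z0) ->
  (forall q, q \in Q i -> z1 * q = q * z1) ->
  symd s (z0 + z1 * (w i * w i)) -> symd s z1.
Proof.
have [[uQ wQ al0] [su sw _] [uu _ _] _] := genP i => z0C z1C zs.
have E : u i * (z0 + z1 * (w i * w i)) * s (u i) = alpha i *: (z0 + z1 * (w i * w i) + z1).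
  rewrite su mulrDr mulrDl -z0C // -mulrA uu -scalerAr mulr1.
  have -> : u i * (z1 * (w i * w i)) * u i = z1 * (u i * (w i * w i * u i)).
    by rewrite !mulrA -z1C.
  rewrite -mulrA wu mulrDr [w i * (_ * _)]mulrA wu !mulrDr !mulrDl !mulrDr.
  rewrite !(mulrA (u i) (u i)) !mulrA -!(mulrA z1) uu -!scalerAl -!scalerAr !mul1r !mulr1 !mulrA.
  by rewrite !scalerDr; cancel2 char2.
have := symd_conj invs (u i) zs; rewrite E => /(symdZ (alpha i)^-1).
rewrite scalerA mulVf // scale1r => /(symdD zs).
by rewrite addrA addvv2 // add0r.
Qed.

(** Peeling off one w_i^2 at a time reduces the claim to scalars g, h of F^2(c) with h + f g
    symmetrized. Then h + f g = 0, so g = 0 or f = h / g. *)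
Lemma norm_form_ratio r y z f : uniq r -> norm_form r y -> norm_form r z ->
  symd s (z + f *: y) -> inL c f \/ y = 0.
Proof.
move=> ur; elim: r ur y z => [|i r IH] /= ur y z.
  move=> [g gL ->] [h hL ->]; rewrite scalerA -scalerDl => /(symd_scal orth) e.
  case: (eqVneq g 0) => [->|g0]; [by right; rewrite scale0r|left].
  have -> : f = h / g.
    have -> : h = f * g by apply/eqP; rewrite -subr_eq0 (oppr_pchar2 char2) e.
    by rewrite mulfK.
  exact: inL_div.
case/andP: ur => ir ur.
move=> [y0 [y1 [hy0 hy1 ->]]] [z0 [z1 [hz0 hz1 ->]]] zs.
have C t : norm_form r t -> forall q, q \in Q i -> t * q = q * t.
  by move=> tn; apply: norm_form_cent tn i ir.
case: (classic (inL c f)) => [|fL]; [by left|right].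
have {}zs : symd s ((z0 + f *: y0) + (z1 + f *: y1) * (w i * w i)).
  by move: zs; rewrite scalerDr mulrDl scalerAl addrACA.
have CD a b : norm_form r a -> norm_form r b -> forall q, q \in Q i ->
    (a + f *: b) * q = q * (a + f *: b).
  by move=> an bn q qQ; rewrite mulrDl mulrDr -scalerAl -scalerAr (C a an) // (C b bn).
have z1s := symd_peel (CD _ _ hz0 hy0) (CD _ _ hz1 hy1) zs.
have y10 : y1 = 0 by case: (IH ur _ _ hy1 hz1 z1s).
move: z1s; rewrite y10 scaler0 addr0 => z1s.
have z10 : z1 = 0.
  case: (IH ur _ _ hz1 (norm_form0 r)) => //.
  by rewrite add0r; apply: symdZ.
move: zs; rewrite y10 z10 scaler0 addr0 !mul0r !addr0 => zs.
by case: (IH ur _ _ hy0 hz0 zs).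
Qed.

(** Write q = k + l w_i with k, l in F[u_i]. Then k^2 and l^2 lie in F^2(c), and the cross terms are
    symmetrized. *)
Lemma norm_quat i q : q \in Q i -> exists l l' q',
  [/\ inL c l, inL c l', q' \in Q i & s q * q = l%:A + l' *: (w i * w i) + (q' + s q')].
Proof.
have [[uQ wQ al0] [su sw _] [uu _ _] sp] := genP i => /sp[k [l [kK lK ->]]].
have KQ m : inK (u i) m -> m \in Q i.
  by move=> [f [g ->]]; rewrite memvD // memvZ.
have KL m : inK (u i) m -> exists2 f, inL c f & m * m = f%:A.
  move=> /(inK_sq char2 uu)[f -> fL]; exists f => //.
  exact: (inL_trans char2 (alL i) fL).
have [f fL kk] := KL _ kK; have [g gL ll] := KL _ lK.
exists f, g, (k * (l * w i)); split=> //; first exact: (QM (KQ _ kK) (QM (KQ _ lK) wQ)).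
rewrite linearD /= !(invM invs) sw (inK_sym invs su kK) (inK_sym invs su lK).
rewrite mulrDl !mulrDr kk -!mulrA (mulrA l l) ll -scalerAl mul1r -scalerAr.
by cancel2 char2.
Qed.

(** Modulo symmetrized elements a -> sigma(a) a is additive, and it is multiplicative on q b for q
    in Q_i and b in the product over r. Keeping z in [cent_out r] makes z + sigma(z), multiplied by
    sigma(q) q, again symmetrized. *)
Lemma norm_formP r a : uniq r -> a \in Qprod r -> exists y z,
  [/\ norm_form r y, cent_out r z & s a * a = y + (z + s z)].
Proof.
elim: r a => [|i r IH] a /= ur; rewrite /Qprod ?big_nil ?big_cons.
  move=> /vlineP[f ->]; exists (f ^+ 2)%:A, 0; split.
  - by exists (f ^+ 2) => //; apply: inL_sq.
  - by move=> j _ q _; rewrite mul0r mulr0.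
  by rewrite linear0 !addr0 linearZ /= (inv1 invs) -scalerAl mul1r scalerA expr2.
case/andP: ur => ir ur aQ.
suff [_ //] : cent_out (i :: r) a /\ exists y z,
  [/\ norm_form (i :: r) y, cent_out (i :: r) z & s a * a = y + (z + s z)].
apply: (prodv_ind (P := fun a => cent_out (i :: r) a /\ exists y z,
  [/\ norm_form (i :: r) y, cent_out (i :: r) z & s a * a = y + (z + s z)]) _ _ _ aQ) => {a aQ}.
- split; first by move=> j _ q _; rewrite mul0r mulr0.
  exists 0, 0; split; [exact: norm_form0| |by rewrite !linear0 mulr0 !addr0].
  by move=> j _ q _; rewrite mul0r mulr0.
- move=> a b [aC [y [z [yn zC ea]]]] [bC [y' [z' [yn' zC' eb]]]].
  split; first exact: cent_outD.
  exists (y + y'), (z + z' + s a * b); split; first exact: norm_formD.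
    by do ?apply: cent_outD => //; apply: cent_outM => //; apply: cent_out_inv.
  rewrite !linearD /= (invM invs) (invK invs) mulrDl !mulrDr ea eb; cancel2 char2.
move=> q b qQ bQ; have bC := Qprod_cent bQ.
split; first by apply: cent_outM; [apply: cent_out_Q|apply: cent_out_cons].
have [y [z [yn zC eb]]] := IH b ur bQ.
have [l [l' [q' [lL lL' qQ' eq]]]] := norm_quat qQ.
have yC := norm_form_cent yn; have sy := norm_form_sym ur yn.
pose t := s q * q; have tQ : t \in Q i by rewrite QM // Qs.
have st : s t = t by rewrite /t (invM invs) (invK invs).
exists (l *: y + (l' *: y) * (w i * w i)), (y * q' + z * t); split.
- by exists (l *: y), (l' *: y); split=> //; apply: norm_formZ.
- apply: cent_outD; apply: cent_outM; try exact: cent_out_cons.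
    exact: cent_out_Q.
  exact: cent_out_Q.
have -> : s (q * b) * (q * b) = (s b * b) * t.
  by rewrite (invM invs) -mulrA (mulrA (s q)) -/t -(bC i ir) // mulrA.
have te : t = _ := eq; clearbody t.
rewrite eb mulrDl linearD /= !(invM invs) sy st -(cent_out_inv zC ir tQ) (mulrDl z).
rewrite {1}te !mulrDr -!scalerAr mulr1 -!scalerAl -(yC _ ir _ (Qs qQ')).
by cancel2 char2.
Qed.

Lemma norm_ratio a b f : \big[@prodv F A/1%VS]_(i < n) Q i = fullv ->
  symd s (s b * b + f *: (s a * a)) -> ~ symd s (s a * a) -> inL c f.
Proof.
move=> Qfull zs as_; have ur : uniq (index_enum 'I_n) by apply: index_enum_uniq.
have inQ y : y \in Qprod (index_enum 'I_n) by rewrite /Qprod Qfull memvf.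
have [y [z [yn _ ea]]] := norm_formP ur (inQ a).
have [y' [z' [yn' _ eb]]] := norm_formP ur (inQ b).
case: (@norm_form_ratio _ y y' f ur yn yn') => // [|y0].
  have -> : y' + f *: y = (s b * b + f *: (s a * a)) + ((z' + s z') + f *: (z + s z)).
    by rewrite ea eb !scalerDr; cancel2 char2.
  by apply: symdD => //; apply: symdD; [exists z'|apply: symdZ; exists z].
by case: as_; rewrite ea y0 add0r; exists z.
Qed.

Lemma Qprod_rem i r : i \in r -> uniq r -> (Qprod r <= Q i * Qprod (rem i r))%VS.
Proof.
elim: r => // j r IH; rewrite inE /= => ir /andP[jr ur].
rewrite /Qprod big_cons -/(Qprod r); case: (eqVneq j i) ir => [-> _|ji] //= ir.
rewrite big_cons -/(Qprod (rem i r)).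
apply: (subv_trans (prodvSr _ (IH ir ur))); rewrite !prodvA; apply: prodvSl.
apply/prodvP => a b aQ bQ; rewrite (QC ji aQ bQ); exact: memv_mul.
Qed.

Variable i0 : 'I_n.
Hypotheses (ai0 : alpha i0 = c) (cns : ~ (exists d : F, c = d ^+ 2)).

Let v := u i0.

Let inKQ k : inK v k -> k \in Q i0.
Proof.
by have [[uQ _ _] _ _ _] := genP i0; move=> [f [g ->]]; rewrite memvD // memvZ.
Qed.

Let vv : v * v = c%:A.
Proof. by have [_ _ [uu _ _] _] := genP i0; rewrite /v uu ai0. Qed.

(* e is the product of the square-zero elements u_j + k_j, where k_j in F[u_i0]
   and k_j ^ 2 = alpha_j. *)
Lemma rank1_partial r : i0 \notin r -> uniq r -> exists e,
  [/\ cent_out (i0 :: r) e, GRing.comm v e, s e = e, e != 0 &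
      forall b, b \in Qprod r -> exists2 k, inK v k & e * b * e = k * e].
Proof.
elim: r => [|j r IH].
  exists 1; split.
  - by move=> j _ q _; rewrite mul1r mulr1.
  - exact: commr1.
  - exact: inv1 invs.
  - exact: oner_neq0.
  rewrite /Qprod big_nil => _ /vlineP[f ->]; exists f%:A; first exact: inKc.
  by rewrite mul1r.
rewrite inE negb_or /= => /andP[i0j i0r] /andP[jr ur].
have [e [eC ve se e0 er]] := IH i0r ur.
have [[uQ wQ al0] [su sw _] [uu uw _] sp] := genP j.
have [[vQ _ _] [sv _ _] _ _] := genP i0; rewrite -/v in vQ sv.
have [k kK kk] := inL_sqrt char2 vv (alL j).
have kQ := inKQ kK; have ji0 : j != i0 by rewrite eq_sym.
have jer : j \notin i0 :: r by rewrite inE negb_or ji0.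
have ku q : q \in Q j -> k * q = q * k by move=> qQ; apply: (QC i0j kQ qQ).
pose ep := u j + k.
have epC : cent_out [:: i0, j & r] ep.
  move=> l; rewrite !inE !negb_or => /and3P[li0 lj lr] q qQ.
  by rewrite /ep mulrDl mulrDr (QC _ uQ qQ) 1?eq_sym // (QC _ kQ qQ) // eq_sym.
have vep : GRing.comm v ep.
  by apply: commrD; [apply: (QC i0j vQ uQ)|apply: inK_commx].
have eep : ep * e = e * ep.
  by rewrite /ep mulrDl mulrDr (eC _ jer _ uQ) (inK_comm kK ve).
have epep : ep * ep = 0.
  by rewrite /ep mulrDl !mulrDr uu kk (ku _ uQ); cancel2 char2.
have uep : u j * ep = k * ep.
  by rewrite /ep !mulrDr uu kk (ku _ uQ) addrC.
have epu : ep * u j = k * ep.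
  by rewrite -uep /ep mulrDl mulrDr (ku _ uQ).
have wep : w j * ep = ep * w j + u j.
  by rewrite /ep mulrDr mulrDl wu (ku _ wQ); cancel2 char2.
have epK m : inK v m -> ep * m = m * ep by move=> mK; rewrite (inK_comm mK vep).
have sep : s ep = ep by rewrite linearD /= su (inK_sym invs sv kK).
have bep b : b \in Qprod r -> b * ep = ep * b.
  move=> bQ; have bC := Qprod_cent bQ.
  by rewrite /ep mulrDr mulrDl (bC j jr _ uQ) (bC i0 i0r _ kQ).
clearbody ep.
have epA f g : ep * (f%:A + g *: u j) = (f%:A + g *: k) * ep.
  by rewrite mulrDr mulrDl -!scalerAr -!scalerAl mulr1 mul1r epu.
exists (ep * e); split.
- apply: cent_outM => // l; rewrite !inE !negb_or => /and3P[li0 lj lr].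
  by apply: eC; rewrite inE negb_or li0.
- exact: commrM.
- by rewrite (invM invs) se sep eep.
(* Commutation with w_j turns ep e into u_j e, which is nonzero because u_j is invertible. *)
- apply: contraNneq e0 => epe; have : u j * e = 0.
    have E : w j * (ep * e) + ep * e * w j = u j * e.
      by rewrite mulrA wep mulrDl -(mulrA ep e) (eC _ jer _ wQ) mulrA; cancel2 char2.
    by rewrite -E epe mulr0 mul0r addr0.
  move/(congr1 (fun y => u j * y)); rewrite mulr0 mulrA uu -scalerAl mul1r => /eqP.
  by rewrite scaler_eq0 (negbTE al0).
rewrite /Qprod big_cons -/(Qprod r); apply: prodv_ind.
- by exists 0; [exact: inK0|rewrite mulr0 !mul0r].
- move=> a b [l lK ea] [m mK eb]; exists (l + m); first exact: inKD.
  by rewrite mulrDr (mulrDl _ _ (ep * e)) ea eb mulrDl.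
move=> q b qQ bQ; have bC := Qprod_cent bQ.
have [m mK em] := er _ bQ.
(* Next to ep the element u_j acts as k, and ep^2 = 0. So only the term u_j of w_j ep = ep w_j + u_j
   contributes. *)
have [l lK el] : exists2 l, inK v l & ep * q * ep = l * ep.
  have [a [_ [[a0 [a1 ->]] [b0 [b1 ->]] ->]]] := sp q qQ.
  have bK : inK v (b0%:A + b1 *: k) by apply: inKD; [exact: inKc|exact: inKZ].
  exists (k * (b0%:A + b1 *: k)); first exact: (inKM vv).
  rewrite mulrDr mulrA !epA mulrDl -!mulrA epep mulr0 add0r wep mulrDr (mulrA ep ep) epep.
  by rewrite mul0r add0r epu !mulrA (inK_commK kK bK).
exists (l * m); first exact: (inKM vv).
have -> : ep * e * (q * b) * (ep * e) = (ep * q * ep) * (e * b * e).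
  rewrite -!mulrA (mulrA e q) (eC _ jer _ qQ) -!mulrA; congr (_ * (_ * _)).
  by rewrite (mulrA b) bep // !mulrA eep.
by rewrite el em -mulrA (mulrA ep) epK // !mulrA.
Qed.

(** Each y commuting with v is a commutator v y' + y' v. For y' = (a + l w) b, with a, l in F[v], w
    the partner of v and b in the product of the other factors, it equals l v b, so [rank1_partial]
    applies. *)
Lemma rank1_exists : \big[@prodv F A/1%VS]_(i < n) Q i = fullv ->
  exists e, [/\ GRing.comm v e, s e = e, e != 0 & rank_le1 v e].
Proof.
move=> Qfull; pose r := rem i0 (index_enum 'I_n).
have ur0 : uniq (index_enum 'I_n) by apply: index_enum_uniq.
have i0r : i0 \notin r by rewrite mem_rem_uniqF.
have ur : uniq r by rewrite rem_uniq.
have [e [_ ve se e0 er]] := rank1_partial i0r ur.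
exists e; split=> // y vy.
have [[vQ wQ _] [sv _ _] [_ uw _] sp] := genP i0; rewrite -/v in vQ sv uw sp.
have c0 : c != 0 by rewrite -ai0; have [[]] := genP i0.
have -> : y = v * (c^-1 *: (w i0 * v * y)) + (c^-1 *: (w i0 * v * y)) * v.
  rewrite -scalerAr -scalerAl -scalerDr -(mulrA _ y) -vy !mulrA.
  by rewrite -!mulrDl uw vv -scalerAl mul1r scalerA mulVf ?scale1r.
have : c^-1 *: (w i0 * v * y) \in (Q i0 * Qprod r)%VS.
  apply: (subvP (Qprod_rem (mem_index_enum i0) ur0)).
  by rewrite /Qprod Qfull memvf.
apply: (prodv_ind (P := fun a => exists2 k, inK v k & e * (v * a + a * v) * e = k * e)).
- by exists 0; [exact: inK0|rewrite mulr0 !mul0r addr0 mulr0 mul0r].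
- move=> a b [l lK ea] [m mK eb]; exists (l + m); first exact: inKD.
  have -> : v * (a + b) + (a + b) * v = (v * a + a * v) + (v * b + b * v).
    by expand2 char2.
  by rewrite mulrDr (mulrDl _ _ e) ea eb mulrDl.
move=> q b qQ bQ; have [k kK ek] := er _ bQ.
have [a [l [aK lK ->]]] := sp q qQ.
have lvK : inK v (l * v) by apply: (inKM vv) => //; apply: inKx.
exists (l * v * k); first exact: (inKM vv).
have bv : b * v = v * b by rewrite (Qprod_cent bQ i0r).
have E : l * (v * w i0 + w i0 * v) * b = l * v * b by rewrite uw.
have -> : v * ((a + l * w i0) * b) + (a + l * w i0) * b * v = l * v * b.
  rewrite -E -(mulrA _ b v) bv !mulrDl !mulrDr !mulrDl !mulrA.
  by rewrite (inK_commx aK) (inK_commx lK); cancel2 char2.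
by rewrite mulrA -(inK_comm lvK ve) -!mulrA (mulrA e) ek !mulrA.
Qed.

End Decomposition.

Section Transport.
Variables (F : fieldType) (A : falgType F) (s : 'End(A)).
Hypotheses (char2 : 2%N \in [pchar F]) (invs : is_involution s).
Hypothesis csaA : is_csa_sub {:A}.
Variables (u x : A) (cu c : F).
Hypotheses (uu : u * u = cu%:A) (su : s u = u).
Hypotheses (xx : x * x = c%:A) (cns : ~ (exists d : F, c = d ^+ 2)) (sx : s x = x).
Hypothesis cL : inL cu c.

(* F[u] contains v with v ^ 2 = x ^ 2; elements z, z' intertwining v and x carry
   e0 to z e0 (s z'). *)
Lemma rank1_transport e0 : GRing.comm u e0 -> s e0 = e0 -> e0 != 0 -> rank_le1 u e0 ->
  exists e, [/\ GRing.comm x e, s e = e, e != 0 & rank_le1 x e].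
Proof.
move=> ue0 se0 e00 re0.
have [v vK vv] := inL_sqrt char2 uu cL.
have sv : s v = v by apply: (inK_sym invs su vK).
have vu k : inK u k -> inK v k.
  case: vK => r [t ev]; case: (eqVneq t 0) => [t0|t0].
    case: cns; exists r; apply/eqP; rewrite -subr_eq0; apply/eqP.
    have : (c - r ^+ 2)%:A = 0 :> A.
      by rewrite scalerBl -vv ev t0 scale0r addr0 -scalerAl mul1r scalerA expr2 subrr.
    by move/eqP; rewrite scaler_eq0 oner_eq0 orbF => /eqP.
  have -> : u = t^-1 *: (v + r%:A).
    by rewrite ev [_%:A + _]addrC -addrA addvv2 // addr0 scalerA mulVf // scale1r.
  move=> [f [g ->]]; apply: inKD; first exact: inKc.
  by do 2! apply: inKZ; apply: inKD; [exact: inKx|exact: inKc].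
have ve0 : GRing.comm v e0 by apply: (inK_comm vK ue0).
have vcu y : GRing.comm v y -> GRing.comm u y.
  by move=> vy; apply: (inK_comm _ vy); apply: vu; apply: inKx.
(* Such z carry the action of v to that of x; every x a + a v is one, since x^2 = v^2. *)
pose W z := x * z = z * v.
have Wad a : W (x * a + a * v).
  rewrite /W mulrDr mulrDl !mulrA xx -(mulrA a) vv -scalerAl -scalerAr mul1r mulr1.
  exact: addrC.
have WK z k : W z -> inK v k -> exists2 k', inK x k' & z * k = k' * z.
  move=> zW [f [g ->]]; exists (f%:A + g *: x); first by exists f, g.
  by rewrite mulrDr mulrDl -!scalerAr -!scalerAl mulr1 mul1r zW.
have We z1 z2 : W z1 -> W z2 -> let e := z1 * e0 * s z2 in GRing.comm x e /\ rank_le1 x e.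
  move=> z1W z2W /=.
  have szW : v * s z2 = s z2 * x by rewrite -{1}sv -{1}sx -!(invM invs) z2W.
  split; first by rewrite /GRing.comm !mulrA z1W -(mulrA z1) ve0 -!mulrA szW.
  move=> y xy; have [|k kK ek] := re0 (s z2 * y * z1).
    by apply: vcu; rewrite /GRing.comm !mulrA szW -(mulrA _ x) xy -!mulrA z1W.
  have [k' kK' ek'] := WK _ _ z1W (vu _ kK); exists k' => //.
  have -> : z1 * e0 * s z2 * y * (z1 * e0 * s z2) = z1 * (e0 * (s z2 * y * z1) * e0) * s z2.
    by rewrite !mulrA.
  by rewrite ek !mulrA ek'.
have [z [z' [zW zW' zz]]] : exists z z', [/\ W z, W z' & z * e0 * s z' != 0].
  have [z zW ze] : exists2 z, W z & z * e0 != 0.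
    apply: NNPP => H; have := csa_free_bimul csaA (s := [:: (x, e0); (1, v * e0)]).
    rewrite /= !memvf => /(_ isT) h; case/eqP: e00.
    apply: (h _ _ (x, e0)); last by rewrite inE eqxx.
      by rewrite -[x]mulr1; apply: (freeK char2 xx cns (oner_neq0 A)).
    move=> a _; rewrite !big_cons big_nil addr0 /= mul1r mulrA -mulrDl.
    by apply/eqP/negPn/negP => n; apply: H; exists (x * a + a * v).
  have zxe : z * e0 * v = x * (z * e0) by rewrite -mulrA -ve0 !mulrA zW.
  apply: NNPP => H; have := csa_free_bimul csaA (s := [:: (x * (z * e0), 1); (z * e0, x)]).
  rewrite /= !memvf => /(_ isT (freeK char2 xx cns ze)) h.
  have /eqP : (1 : A) = 0; last by rewrite oner_eq0.
  apply: (h _ (x * (z * e0), 1)); last by rewrite inE eqxx.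
  move=> b _; rewrite !big_cons big_nil addr0 /= mulr1 -zxe.
  apply/eqP/negPn/negP => n; apply: H; exists z, (x * s b + s b * v); split=> //.
  rewrite linearD /= !(invM invs) (invK invs) sx sv mulrDr.
  by rewrite !mulrA addrC.
have sE z1 z2 : s (z1 * e0 * s z2) = z2 * e0 * s z1.
  by rewrite !(invM invs) (invK invs) se0 mulrA.
(* If y e0 sigma(y) vanishes for every intertwiner y, then polarizing at z + z' shows that z e0
   sigma(z') is symmetric. *)
suff [y yW y0] : exists2 y, W y & y * e0 * s y != 0 \/ s (z * e0 * s z') = z * e0 * s z'.
  case: y0 => [y0|sy].
    by exists (y * e0 * s y); have [? ?] := We _ _ yW yW; split.
  by exists (z * e0 * s z'); have [? ?] := We _ _ zW zW'; split.
apply: NNPP => H.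
have H0 y : W y -> y * e0 * s y = 0.
  by move=> yW; apply/eqP/negPn/negP => n; apply: H; exists y => //; left.
apply: H; exists z => //; right; rewrite sE; apply: (eq_add2 char2).
have WD : W (z + z') by rewrite /W mulrDr mulrDl zW zW'.
have := H0 _ WD; rewrite linearD /= mulrDl !mulrDr !mulrDl (H0 _ zW) (H0 _ zW') add0r addr0.
by [].
Qed.

End Transport.

(** * The socle of an inseparable subalgebra *)

Section InsepQuat.
Variables (F : fieldType) (A : falgType F) (s : 'End(A)).
Hypotheses (char2 : 2%N \in [pchar F]) (invs : is_involution s) (orth : orthogonal_char2 s).
Hypothesis csaA : is_csa_sub {:A}.
Variables (x : A) (c : F).
Hypotheses (xx : x * x = c%:A) (cns : ~ (exists d : F, c = d ^+ 2)) (sx : s x = x).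

Section Socle.
Variables (n : nat) (S : {vspace A}).
Hypotheses (insS : is_insep_sub s n S) (xS : x \in S).
Hypothesis SL : forall y f, y \in S -> y * y = f%:A -> inL c f.

Let S1 : 1 \in S. Proof. by case: insS => -[]. Qed.
Let SM y z : y \in S -> z \in S -> y * z \in S.
Proof. by case: insS => -[_ /prodvP h] _ _ _ _; apply: h. Qed.
Let Ssym y : y \in S -> s y = y.
Proof. by case: insS => _ _ h _ _ /h[]. Qed.
Let Scent y : (forall z, z \in S -> y * z = z * y) -> y \in S.
Proof. by move=> h; have [_ _ _ <- _] := insS; apply/centvP. Qed.
Let SC y z : y \in S -> z \in S -> y * z = z * y.
Proof. by move=> yS zS; have [_ _ _ CS _] := insS; move: yS; rewrite -CS => /centvP h; apply: h. Qed.
Let SK k : inK x k -> k \in S.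
Proof. by move=> [f [g ->]]; rewrite memvD ?memvZ. Qed.
Let Sx y : y \in S -> GRing.comm x y. Proof. by move=> yS; apply: SC. Qed.

(** Since y^2 lies in F^2(c), it equals k^2 for some k in K, and y + k squares to zero. So S is
    local with residue field K. *)
Let nil_part y : y \in S -> exists k t, [/\ inK x k, t \in S, t * t = 0 & y = k + t].
Proof.
move=> yS; have [_ _ /(_ _ yS)[_ [f yy]] _ _] := insS.
have [k kK kk] := inL_sqrt char2 xx (SL yS yy).
exists k, (k + y); split=> //; [by apply: memvD => //; apply: SK| |by rewrite addKK2].
by rewrite mulrDl !mulrDr yy kk (SC yS (SK kK)); cancel2 char2.
Qed.

(** By [nil_part] the square-zero elements are the maximal ideal of S, and the socle is its
    annihilator. *)
Definition in_socle e := e \in S /\ forall t, t \in S -> t * t = 0 -> t * e = 0.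

(** As long as some square-zero t does not kill y, replace y by t y: the ideal y S shrinks properly
    because t is nilpotent. *)
Lemma socle_multiple y : y \in S -> y != 0 ->
  exists z, [/\ z \in S, z * y != 0 & in_socle (z * y)].
Proof.
suff H m : forall y, (\dim (amull y @: S) < m)%N -> y \in S -> y != 0 ->
    exists z, [/\ z \in S, z * y != 0 & in_socle (z * y)].
  by apply: (H _ y (ltnSn _)).
elim: m => // m IH {}y dy yS y0.
case: (classic (in_socle y)) => [soc|nsoc]; first by exists 1; rewrite mul1r.
have [t [tS tt ty]] : exists t, [/\ t \in S, t * t = 0 & t * y <> 0].
  apply: NNPP => H; apply: nsoc; split=> // t tS tt; apply: NNPP => nz; apply: H.
  by exists t.
have ty0 : t * y != 0 by apply/eqP.
have [||z [zS z0 zs]] := IH (t * y) _ _ ty0; last 1 first.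
- by exists (z * t); rewrite -mulrA; split=> //; apply: SM.
- rewrite ltnS in dy; apply: leq_trans dy; rewrite ltnNge; apply/negP => le.
  have sub : (amull (t * y)%R @: S <= amull y @: S)%VS.
    apply/subvP => _ /memv_imgP[z zS ->]; rewrite lfunE /=.
    have -> : t * y * z = amull y (t * z) by rewrite lfunE /= (SC tS yS) mulrA.
    by rewrite memv_img // SM.
  have /eqP E : (amull (t * y)%R @: S == amull y @: S)%VS by rewrite eqEdim sub le.
  have : y \in (amull y @: S)%VS.
    by have := memv_img (amull y) S1; rewrite lfunE /= mulr1.
  rewrite -E => /memv_imgP[z zS]; rewrite lfunE /= => ey; apply: ty.
  by rewrite ey !mulrA tt !mul0r.
- exact: SM.
Qed.

(** The element e b f commutes with K and is killed on both sides by the square-zero elements of S.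
    So it lies in the centralizer of S, which is S, and is symmetric. *)
Lemma socle_sym e f b : in_socle e -> in_socle f -> GRing.comm x b ->
  e * b * f = f * s b * e.
Proof.
move=> [eS eN] [fS fN] xb; have ebfS : e * b * f \in S.
  apply: Scent => y yS; have [k [t [kK tS tt ->]]] := nil_part yS.
  have bt : e * b * f * t = 0 by rewrite -mulrA (SC fS tS) (fN _ tS tt) mulr0.
  have tb : t * (e * b * f) = 0 by rewrite !mulrA (eN _ tS tt) !mul0r.
  rewrite mulrDr mulrDl bt tb !addr0 (inK_comm kK) //.
  by apply: (commrM _ (Sx fS)); apply: (commrM _ xb); apply: Sx.
by rewrite -(Ssym ebfS) !(invM invs) (Ssym eS) (Ssym fS) mulrA.
Qed.

(** Repeated use of [socle_sym] gives e b e d e = e d e b e, so e b e lies in K e by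
    [centK_centroid]. *)
Lemma socle_rank1 e : in_socle e -> e != 0 -> rank_le1 x e.
Proof.
move=> soc e0 b xb; have xe : GRing.comm x e by apply: Sx; case: soc.
apply: (centK_centroid char2 xx cns csaA xe _ e0).
  by do ?apply: commrM.
move=> d xd.
have E y : GRing.comm x y -> e * y * e = e * s y * e by apply: socle_sym.
have xbed : GRing.comm x (b * e * d) by do ?apply: commrM.
have -> : e * b * e * d * e = e * (b * e * d) * e by rewrite !mulrA.
rewrite E // !(invM invs) (Ssym (proj1 soc)) !mulrA -(E _ xd).
by rewrite -(mulrA _ e (s b)) -(mulrA _ (e * s b) e) -(E _ xb) !mulrA.
Qed.

(** Some e b f is nonzero. By [socle_sym] it lies in both e C e and f C f, so it is a K-multiple of
    e and of f. *)
Lemma socle_line e f : in_socle e -> e != 0 -> in_socle f -> f != 0 ->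
  exists2 k, inK x k & f = k * e.
Proof.
move=> soce e0 socf f0.
have re := socle_rank1 soce e0; have rf := socle_rank1 socf f0.
have xe : GRing.comm x e by apply: Sx; case: soce.
have xf : GRing.comm x f by apply: Sx; case: socf.
have [b xb ebf] := centK_prime_ex char2 csaA xx cns xe xf e0 f0.
have one e' : GRing.comm x e' -> e' != 0 -> rank_le1 x e' ->
    exists2 a, GRing.comm x a & e' * a * e' = e'.
  move=> xe' e0' re'; have [a xa ea] := centK_prime_ex char2 csaA xx cns xe' xe' e0' e0'.
  have [k kK ek] := re' _ xa.
  have k0 : k != 0 by apply: contraNneq ea => k0; rewrite ek k0 mul0r.
  have [l [lK kl lk]] := inK_inv char2 xx cns kK k0.
  exists (l * a); first by apply: commrM => //; apply: inK_commx.
  by rewrite mulrA -(inK_comm lK xe') -!mulrA (mulrA e') ek mulrA lk mul1r.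
have [a xa ea] := one e xe e0 re; have [a' xa' ea'] := one f xf f0 rf.
have [k kK ek] : exists2 k, inK x k & e * b * f = k * e.
  have [|k kK ek] := re (b * f * a); first by do ?apply: commrM.
  exists k => //; rewrite -ek (socle_sym soce socf xb) -{1}ea !mulrA.
  by rewrite -(socle_sym soce socf xb).
have [l lK el] : exists2 l, inK x l & e * b * f = l * f.
  have [|l lK el] := rf (s b * e * a'); first by do ?apply: commrM => //; apply: inv_comm.
  exists l => //; rewrite -el -{1}ea' !mulrA (socle_sym soce socf xb) //.
have l0 : l != 0 by apply: contraNneq ebf => l0; rewrite el l0 mul0r.
have [l' [lK' ll' l'l]] := inK_inv char2 xx cns lK l0.
exists (l' * k); first exact: (inKM xx).
by rewrite -mulrA -ek el mulrA l'l mul1r.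
Qed.

End Socle.
End InsepQuat.

Section OrthonormalNth.
Variables (F : fieldType) (A : falgType F) (s : 'End(A)).
Hypothesis invs : is_involution s.
Variable p : A.

Lemma orthonormal_nth vs i j : orthofam s p vs -> (i < size vs)%N -> (j < size vs)%N ->
  s vs`_i * vs`_j = if i == j then p else 0.
Proof.
elim: vs i j => // v vs IH [|i] [|j] [vv vu ovs] //= iv jv.
- by rewrite vu // mem_nth.
- by rewrite -[v](invK invs) -(invM invs) vu ?linear0 // mem_nth.
by rewrite IH.
Qed.

Lemma proj_nth vs : famproj s vs = \sum_(i < size vs) vs`_i * s vs`_i.
Proof. by rewrite /famproj (big_nth 0) big_mkord. Qed.

End OrthonormalNth.

(** * The two implications *)

Section Equivalence.
Variables (F : fieldType) (A : falgType F) (s : 'End(A)).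
Hypotheses (char2 : 2%N \in [pchar F]) (invs : is_involution s) (orth : orthogonal_char2 s).
Hypothesis csaA : is_csa_sub {:A}.
Variables (x : A) (c : F).
Hypotheses (xx : x * x = c%:A) (cns : ~ (exists d : F, c = d ^+ 2)) (sx : s x = x).

Lemma insep_quaternion n (S : {vspace A}) : is_insep_sub s n S -> x \in S ->
  (forall y f, y \in S -> y * y = f%:A -> inL c f) ->
  exists Q0 : {vspace A}, [/\ is_quat_sub Q0, sigma_inv s Q0 & x \in Q0].
Proof.
move=> insS xS SL.
have [[S1 /prodvP SM] _ Ssp CS _] := insS.
have SC y z : y \in S -> z \in S -> y * z = z * y.
  by move=> yS zS; move: yS; rewrite -CS => /centvP h; apply: h.
have Ssym y : y \in S -> s y = y by move=> /Ssp[].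
have SK k : inK x k -> k \in S by move=> [f [g ->]]; rewrite memvD ?memvZ.
have Sx y : y \in S -> GRing.comm x y by move=> yS; apply: SC.
have [z0 [_ z0n soce]] := socle_multiple insS S1 (oner_neq0 A).
move: (z0 * 1) z0n soce => e e0 soce {z0}; have [eS _] := soce.
have xe := Sx _ eS; have se := Ssym _ eS.
have re : rank_le1 x e by apply: (socle_rank1 char2 invs csaA xx cns insS xS SL soce e0).
have esym b : GRing.comm x b -> e * b * e = e * s b * e.
  by apply: (socle_sym char2 invs xx insS xS SL soce soce).
(* One element satisfies each inequality. If neither satisfies both, their sum does, the cross terms
   cancelling by [esym]. *)
have [b [xb ebe ebb]] : exists b, [/\ GRing.comm x b, e * b * e != 0 & e * s b * b * e != 0].
  have [b xb eb] := rank1_anisotropic char2 invs orth csaA xx cns sx xe se e0 re.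
  have [a xa ea] := centK_prime_ex char2 csaA xx cns xe xe e0 e0.
  have [ebe|ebe] := eqVneq (e * b * e) 0; last by exists b.
  have [eaa|eaa] := eqVneq (e * s a * a * e) 0; last by exists a.
  exists (b + a); split; first exact: commrD.
    by rewrite mulrDr mulrDl ebe add0r.
  have E : e * s b * a * e = e * s a * b * e.
    have := esym (s b * a) (commrM (inv_comm invs sx xb) xa).
    by rewrite (invM invs) (invK invs) !mulrA.
  by rewrite linearD /= mulrDr !mulrDl mulrDr !mulrDl eaa E addr0 -addrA addvv2 // addr0.
have [|k0 k0K ek0] := re (s b * b); first by apply: (commrM _ xb); apply: inv_comm.
rewrite !mulrA in ek0.
have k00 : k0 != 0 by apply: contraNneq ebb => k00; rewrite ek0 k00 mul0r.
have [l [lK lk0 []]] := rank1_idempotent char2 invs xx cns sx xe se e0 re xb k0K k00 ek0.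
set p := l * (b * e * s b) => pp [xp sp p0 rp].
have [kap kapK ekap] := re _ xb.
have xsb := inv_comm invs sx xb.
have kap0 : kap != 0 by apply: contraNneq ebe => k0'; rewrite ekap k0' mul0r.
(* So p e p is an invertible K-multiple of p, which makes the form on S p nondegenerate. *)
have pep : p * e * p = l * (kap * kap) * p.
  have -> : p * e * p = l * b * ((e * s b * e) * (l * (b * e))) * s b by rewrite /p !mulrA.
  have -> : e * s b * e * (l * (b * e)) = l * (kap * kap * e).
    rewrite -esym // ekap -!mulrA (mulrA e l) -(inK_comm lK xe) -!mulrA (mulrA e b) ekap.
    by rewrite !mulrA (inK_commK kapK lK).
  rewrite /p; have kkK : inK x (kap * kap) by apply: (inKM xx).
  have lbC : b * (l * (kap * kap)) = l * (kap * kap) * b.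
    by rewrite (inK_comm _ xb) //; apply: (inKM xx).
  have -> : l * b * (l * (kap * kap * e)) * s b = l * (b * (l * (kap * kap))) * e * s b.
    by rewrite !mulrA.
  have E : l * (kap * kap) * l = l * l * (kap * kap).
    by rewrite -mulrA (inK_commK kkK lK) mulrA.
  by rewrite lbC [RHS]mulrA E !mulrA.
clearbody p.
pose U y := exists2 t, t \in S & y = t * p.
have [vs [ovs vU vid]] : exists vs, [/\ orthofam s p vs,
    forall v, v \in vs -> U v & forall y, U y -> famproj s vs * y = y].
  apply: (orthonormal_basis char2 invs xx cns sx sp p0 rp).
  - move=> _ [t tS ->]; split; last by rewrite -mulrA pp.
    exact: (commrM (Sx _ tS) xp).
  - by move=> _ _ [t tS ->] [t' tS' ->]; exists (t + t'); rewrite ?mulrDl ?memvD.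
  - by move=> k _ kK [t tS ->]; exists (k * t); [apply: SM => //; apply: SK|rewrite mulrA].
  - by exists 1; rewrite ?mul1r.
  - move=> _ [t tS ->] tp0.
    have t0 : t != 0 by apply: contraNneq tp0 => ->; rewrite mul0r.
    (* A multiple z t lies in the socle, so z t = k e, and pairing t p with z p gives k p e p. *)
    have [z [zS zt0 socz]] := socle_multiple insS tS t0.
    have [k kK ek] := socle_line char2 invs csaA xx cns sx insS xS SL soce e0 socz zt0.
    have k1 : k != 0 by apply: contraNneq zt0 => k1; rewrite ek k1 mul0r.
    pose m := k * (l * (kap * kap)).
    have mK : inK x m by do 3! [apply: (inKM xx) => //].
    have l0 : l != 0.
      by apply: contraNneq (oner_neq0 A) => l0; rewrite -lk0 l0 mul0r.
    have m0 : m != 0.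
      apply/eqP => /(inK_cancel char2 xx cns kK)[/eqP|]; first by rewrite (negbTE k1).
      move=> /(inK_cancel char2 xx cns lK)[/eqP|]; first by rewrite (negbTE l0).
      by move=> /(inK_cancel char2 xx cns kapK)[] /eqP; rewrite (negbTE kap0).
    have [m' [mK' mm' m'm]] := inK_inv char2 xx cns mK m0.
    exists (m' * z * p); first by exists (m' * z) => //; apply: SM => //; apply: SK.
    have -> : s (t * p) * (m' * z * p) = m' * (p * (z * t) * p).
      rewrite (invM invs) sp (Ssym _ tS) !mulrA (inK_comm mK' xp) -(mulrA p t m').
      by rewrite (SC _ _ tS (SK _ mK')) -!mulrA (mulrA t z) (SC _ _ tS zS) !mulrA.
    rewrite ek mulrA (mulrA p k e) -(inK_comm kK xp).
    by rewrite -!mulrA (mulrA p e p) pep (mulrA k) -/m mulrA m'm mul1r.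
  move=> _ [t tS ->]; have [_ [f tt]] := Ssp _ tS.
  have [k kK kk] := inL_sqrt char2 xx (SL _ _ tS tt); exists k => //.
  rewrite (invM invs) sp (Ssym _ tS) kk !mulrA -(mulrA p) tt.
  by rewrite -scalerAr mulr1 -!scalerAl mul1r pp.
set g := famproj s vs in vid.
have sg : s g = g by apply: proj_sym.
(* Left multiplication by r preserves S p, which contains the family and is fixed by g. Applying
   sigma shows that g commutes with r. *)
have grg r : r \in S -> g * r * g = r * g.
  move=> rS; rewrite {2 3}/g /famproj !mulr_sumr big_seq [RHS]big_seq; apply: eq_bigr => v /vU[t tS ev].
  by rewrite !mulrA -(mulrA g) vid // ev; exists (r * t); rewrite ?SM ?mulrA.
have gS : g \in S.
  rewrite -CS; apply/centvP => r rS; have := congr1 s (grg _ rS).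
  by rewrite !(invM invs) sg (Ssym _ rS) mulrA grg.
have gg : g * g = g by have := grg _ S1; rewrite mulr1 mul1r.
(* As g lies in S, its square, which is g itself, is a scalar; and g fixes p. *)
have g1 : g = 1.
  have [_ [f]] := Ssp _ gS; rewrite gg => gf.
  have : g * p = p by apply: vid; exists 1; rewrite ?mul1r.
  rewrite gf -scalerAl mul1r -{2}[p]scale1r => /eqP.
  by rewrite -subr_eq0 -scalerBl scaler_eq0 (negbTE p0) orbF subr_eq0 => /eqP ->; rewrite scale1r.
have vprop (i : 'I_(size vs)) : GRing.comm x vs`_i /\ vs`_i * p = vs`_i.
  have [t tS ->] := vU _ (mem_nth 0 (ltn_ord i)).
  by split; [exact: (commrM (Sx _ tS) xp)|rewrite -mulrA pp].
apply: (corner_quaternion char2 invs csaA xx cns sx pp xp sp p0 rp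
   (v := fun i : 'I_(size vs) => vs`_i)).
- by move=> i; case: (vprop i).
- by move=> i; case: (vprop i).
- by move=> i j; rewrite (orthonormal_nth invs ovs).
- by rewrite -proj_nth -/g.
Qed.

Lemma quaternion_insep n : \dim {:A} = (2 ^ n.+1 * 2 ^ n.+1)%N -> symd s x ->
  (forall a b f, symd s (s b * b + f *: (s a * a)) -> ~ symd s (s a * a) -> inL c f) ->
  (exists e, [/\ GRing.comm x e, s e = e, e != 0 & rank_le1 x e]) ->
  exists S : {vspace A}, is_insep_sub s n.+1 S /\ x \in S.
Proof.
move=> dimA xs ratio [e [xe se e0 re]].
have [b xb eb] := rank1_anisotropic char2 invs orth csaA xx cns sx xe se e0 re.
have [|k0 k0K ek0] := re (s b * b); first by apply: (commrM _ xb); apply: inv_comm.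
rewrite !mulrA in ek0.
have k00 : k0 != 0 by apply: contraNneq eb => k00; rewrite ek0 k00 mul0r.
have [l [lK lk0 []]] := rank1_idempotent char2 invs xx cns sx xe se e0 re xb k0K k00 ek0.
move: (l * _) => p pp [xp sp p0 rp] {e xe se e0 re b xb eb k0 k0K ek0 k00 l lK lk0}.
have xps : symd s (x * p).
  have := symd_conj invs p xs; by rewrite sp -xp -mulrA pp.
have np : ~ symd s p.
  by move=> ps; apply: (rank1_sym_not_symd char2 invs orth csaA xx cns sx xp sp p0 rp).
have c0 : c != 0 by apply/eqP => c0; apply: cns; exists 0; rewrite c0 expr0n.
pose U y := GRing.comm x y /\ y * p = y.
have [vs [ovs vU vid]] : exists vs, [/\ orthofam s p vs,
    forall v, v \in vs -> U v & forall y, U y -> famproj s vs * y = y].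
  apply: (orthonormal_basis char2 invs xx cns sx sp p0 rp) => //.
  - by move=> y z [xy yp] [xz zp]; split; [exact: commrD|rewrite mulrDl yp zp].
  - move=> k y kK [xy yp]; split; last by rewrite -mulrA yp.
    by apply: commrM => //; apply: inK_commx.
  - move=> y [xy yp] y0; have xsy := inv_comm invs sx xy.
    have sy0 : s y != 0 by apply: contraNneq y0 => sy0; rewrite -[y](invK invs) sy0 linear0.
    have [d xd sydp] := centK_prime_ex char2 csaA xx cns xsy xp sy0 p0.
    have [|k kK ek] := rp (s y * d); first exact: commrM.
    have psy : p * s y = s y by rewrite -{1}sp -(invM invs) yp.
    rewrite mulrA psy in ek.
    have k1 : k != 0 by apply: contraNneq sydp => k1; rewrite ek k1 mul0r.
    have [l [lK kl lk]] := inK_inv char2 xx cns kK k1.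
    exists (l * (d * p)).
      split; last by rewrite -!mulrA pp.
      by apply: commrM; [exact: inK_commx|exact: commrM].
    by rewrite (mulrA (s y) l) -(inK_comm lK xsy) -(mulrA l) (mulrA (s y) d) ek mulrA lk mul1r.
  move=> y [xy yp]; have xsy := inv_comm invs sx xy.
  have psy : p * s y = s y by rewrite -{1}sp -(invM invs) yp.
  have [|k [f [g ->]] ek] := rp (s y * y); first exact: commrM.
  rewrite mulrA psy -mulrA yp in ek.
  (* As x is symmetrized, so is x sigma(y) y = f x p + g c p; a nonzero g would make p
     symmetrized. *)
  have g0 : g = 0.
    case: (eqVneq g 0) => // g0; case: np.
    have : symd s (x * (s y * y)).
      by have := symd_conj invs (s y) xs; rewrite (invK invs) -xsy -mulrA.
    rewrite ek mulrA mulrDr -!scalerAr mulr1 xx scalerA mulrDl -!scalerAl mul1r.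
    move=> /symdD/(_ (symdZ f xps)); rewrite addrAC addvv2 // add0r => /(symdZ (g * c)^-1).
    by rewrite scalerA mulVf ?scale1r // mulf_neq0.
  rewrite g0 scale0r addr0 -scalerAl mul1r in ek.
  have fL : inL c f.
    apply: (ratio p y); last by rewrite sp pp.
    by rewrite sp pp ek addvv2 //; apply: symd0.
  have [k2 k2K kk] := inL_sqrt char2 xx fL; exists k2 => //.
  by rewrite kk -scalerAl mul1r.
(* The projection fixes C p, so its sum with 1 annihilates C p and vanishes by primeness of C. *)
have proj1 : famproj s vs = 1.
  have xg : GRing.comm x (famproj s vs).
    rewrite /famproj big_seq; apply: (big_ind (fun y => GRing.comm x y)); first exact: commr0.
      by move=> *; apply: commrD.
    by move=> v /vU[xv _]; apply: commrM => //; apply: inv_comm.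
  apply: (eq_add2 char2).
  have [| |d xd|//|/eqP] := centK_prime char2 xx cns csaA (a := famproj s vs + 1) (b := p).
  - by apply: commrD => //; apply: commr1.
  - exact: xp.
  - rewrite mulrDl mulrDl mul1r -mulrA vid ?addvv2 //.
    by split; [exact: commrM|rewrite -mulrA pp].
  by rewrite (negbTE p0).
have vC (i : 'I_(size vs)) : GRing.comm x vs`_i by case: (vU _ (mem_nth 0 (ltn_ord i))).
have vp (i : 'I_(size vs)) : vs`_i * p = vs`_i by case: (vU _ (mem_nth 0 (ltn_ord i))).
have szvs : size vs = (2 ^ n)%N.
  have D := grid_dim char2 invs csaA xx cns pp xp sp p0 rp (v := fun i : 'I_(size vs) => vs`_i) vp.
  have {}D : (2 ^ n.+1 * 2 ^ n.+1 = 4 * size vs ^ 2)%N.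
    rewrite -dimA -(card_ord (size vs)); apply: D => [i j|]; last by rewrite -proj_nth.
    by rewrite (orthonormal_nth invs ovs).
  apply/eqP; rewrite -(eqn_exp2r _ _ (isT : 0 < 2)%N) -(eqn_pmul2l (isT : 0 < 4)%N) -D.
  by rewrite expnS mulnACA -mulnn.
(* There are 2^n basis vectors, so they can be indexed by (Z/2)^n, whose translations permute
   them. *)
pose T := 'rV['F_2]_n.
have cardT : #|T| = size vs by rewrite card_mx card_Fp // mul1n szvs.
pose v (t : T) := vs`_(enum_rank t).
have lt (t : T) : (enum_rank t < size vs)%N by rewrite -cardT ltn_ord.
exists (shift_alg s x v).
have vvT i j : s (v i) * v j = if i == j then p else 0.
  rewrite /v (orthonormal_nth invs ovs) // (_ : (_ == _ :> nat) = (i == j)) //.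
  by rewrite (inj_eq val_inj) (inj_eq enum_rank_inj).
have v1T : \sum_i v i * s (v i) = 1.
  rewrite -proj1 proj_nth -cardT (reindex (fun t : T => enum_rank t)) //.
  exact/onW_bij/enum_rank_bij.
have vCT i : GRing.comm x (v i) by apply: (vC (Ordinal (lt i))).
have vpT i : v i * p = v i by apply: (vp (Ordinal (lt i))).
split; last exact: (shift_alg_x x vpT vvT v1T).
exact: (shift_alg_insep char2 invs xx cns sx p0 rp vCT vpT vvT v1T sp).
Qed.

End Equivalence.

(** * The equivalence for a given decomposition *)

Theorem theorem5p10 (F : fieldType) (A : falgType F) (n : nat)
  (s : 'End(A)) (Q : 'I_n -> {vspace A}) (alpha : 'I_n -> F) (x : A) :
  2%N \in [pchar F] ->
  is_csa_sub (fullv : {vspace A}) -> \dim {:A} = (2 ^ n * 2 ^ n)%N ->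
  is_involution s -> orthogonal_char2 s ->
  total_decomp s Q -> (forall i, disc_rep s (Q i) (alpha i)) ->
  (0 < n)%N -> pf_index [seq alpha i | i <- enum 'I_n] n.-1 ->
  sym_plus s x -> ~ (exists d : F, x * x = (d ^+ 2)%:A) ->
  ((exists Q0 : {vspace A}, [/\ is_quat_sub Q0, sigma_inv s Q0 & x \in Q0]) <->
   (exists S : {vspace A}, is_insep_sub s n S /\ x \in S)).
Proof.
move=> char2 csaA dimA invs orth [Qq QC Qfull] disc n0 pfi [sx [c xx]] nsq.
have cns : ~ (exists d : F, c = d ^+ 2) by case=> d cd; apply: nsq; exists d; rewrite -cd.
have [i0 ans alL] := pf_index_inL char2 n0 pfi.
have /fin_all_exists[gen Qgen] : forall i, exists uw, quat_gens s (Q i) (alpha i) uw.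
  move=> i; have [qi si] := Qq i.
  exact: (quat_gens_exist char2 invs orth qi si (disc i)).
have Qs i y : y \in Q i -> s y \in Q i.
  by move=> yQ; have [_ si] := Qq i; apply: (subvP si); apply: memv_img.
have QM i y z : y \in Q i -> z \in Q i -> y * z \in Q i.
  by have [[ci _] _] := Qq i; apply: csa_memM.
have Q1 i : 1 \in Q i by have [[ci _] _] := Qq i; apply: csa_mem1.
have ratio a b f : symd s (s b * b + f *: (s a * a)) -> ~ symd s (s a * a) -> inL (alpha i0) f.
  exact: (norm_ratio char2 invs orth QC Qs QM Q1 Qgen alL Qfull).
have one : ~ symd s (s 1 * 1) by rewrite mulr1 (inv1 invs) => -[q e]; apply: orth; exists q.
have sqL y f : s y = y -> y * y = f%:A -> inL (alpha i0) f.
  move=> sy yy; apply: (ratio 1 y) => //.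
  by rewrite sy yy (inv1 invs) mulr1 (addvv2 char2); apply: symd0.
(* By exchange, every non-square of F^2(alpha_i0) generates this field. *)
have aL c' f : inL (alpha i0) c' -> ~ (exists d : F, c' = d ^+ 2) -> inL (alpha i0) f -> inL c' f.
  by move=> cL c'ns; apply: inL_trans => //; apply: inL_exchange.
split=> [[Q0 [qQ0 sQ0 xQ0]]|[S [insS xS]]]; last first.
  apply: (insep_quaternion char2 invs orth csaA xx cns sx insS xS) => y f yS yy.
  apply: aL => //; first exact: sqL sx xx.
  by case: insS => _ _ /(_ _ yS)[sy _] _ _; apply: sqL yy.
(* Let w satisfy x w + w x = x in the quaternion subalgebra, so that w + sigma(w) = f + g x. If g is
   nonzero, x + f / g is symmetrized. If g = 0, then f = 0, so w is symmetric and x = x w + sigma(x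
   w). *)
have [h xh] : exists h : F, symd s (x + h%:A).
  have xF : ~ (exists f : F, x = f%:A).
    by case=> f xf; apply: nsq; exists f; rewrite xf -scalerAl mul1r scalerA expr2.
  have [w wQ xw] := quat_ad char2 qQ0 xQ0 xx xF.
  have swQ : s w \in Q0 by apply: (subvP sQ0); apply: memv_img.
  have xww : GRing.comm x (w + s w).
    have E := congr1 s xw; rewrite linearD /= !(invM invs) sx in E.
    apply: (eq_add2 char2); rewrite mulrDr mulrDl.
    transitivity ((x * w + w * x) + (s w * x + x * s w)); first by cancel2 char2.
    by rewrite xw E (addvv2 char2).
  have [f [g e]] := quat_cent char2 qQ0 xQ0 xx xF (memvD wQ swQ) xww.
  case: (eqVneq g 0) => [g0|g0]; last first.
    exists (g^-1 * f); have -> : x + (g^-1 * f)%:A = g^-1 *: (w + s w).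
      by rewrite e scalerDr !scalerA mulVf // scale1r addrC.
    by apply: symdZ; exists w.
  have f0 : f = 0.
    apply: (symd_scal orth); exists w; by rewrite e g0 scale0r addr0.
  exists 0; rewrite scale0r addr0; exists (x * w).
  have sw : s w = w by apply/esym/(eq_add2 char2); rewrite e f0 g0 !scale0r addr0.
  by rewrite (invM invs) sx sw xw.
(* The shift by a scalar does not change F[x], so an inseparable subalgebra containing x' also
   contains x. *)
pose x' := x + h%:A.
have xx' : x' * x' = (c + h ^+ 2)%:A.
  rewrite /x' mulrDl !mulrDr xx -scalerAr -!scalerAl !mul1r mulr1 scalerA scalerDl expr2.
  by cancel2 char2.
have sx' : s x' = x' by rewrite linearD linearZ /= sx (inv1 invs).
have cns' : ~ (exists d : F, c + h ^+ 2 = d ^+ 2).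
  case=> d e; apply: cns; exists (d + h); rewrite (sqrD2 char2) -e -addrA.
  by rewrite (addrr_pchar2 char2) addr0.
have cL' : inL (alpha i0) (c + h ^+ 2) by apply: sqL sx' xx'.
have [e0 [ue0 se0 e00 re0]] := rank1_exists char2 invs QC Q1 Qgen alL (erefl (alpha i0)) Qfull.
have [_ [su _ _] [uu _ _] _] := genP Qgen i0.
have re := rank1_transport char2 invs csaA uu su xx' cns' sx' cL' ue0 se0 e00 re0.
have dimA' : \dim {:A} = (2 ^ n.-1.+1 * 2 ^ n.-1.+1)%N by rewrite prednK.
have ratio' a b f : symd s (s b * b + f *: (s a * a)) -> ~ symd s (s a * a) ->
    inL (c + h ^+ 2) f.
  by move=> zs as_; apply: aL => //; apply: ratio zs as_.
have [S [insS xS]] := quaternion_insep char2 invs orth csaA xx' cns' sx' dimA' xh ratio' re.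
rewrite prednK // in insS; exists S; split=> //.
have -> : x = x' + h%:A by rewrite -addrA (addvv2 char2) addr0.
by rewrite memvD // memvZ //; case: insS => -[].
Qed.
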